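(* Let $(\mathcal{P},\cdot,\{-,-\})$ be a complex Poisson algebra of dimension three. Then $\mathcal{P}$ has a basis $e_1,e_2,e_3$ in which it is isomorphic to one of the following Poisson algebras (only nonzero products $e_i\cdot e_j$ and $\{e_i,e_j\}$ with $i\le j$, resp. $i<j$, are listed; the rest are zero or follow from commutativity of $\cdot$ and anticommutativity of $\{-,-\}$): $\mathcal{P}_{3,1}$: all products zero; $\mathcal{P}_{3,2}$: $\{e_1,e_2\}=e_3$; $\mathcal{P}_{3,3}$: $\{e_1,e_2\}=e_2$, $\{e_1,e_3\}=e_2+e_3$; $\mathcal{P}_{3,4}^{\alpha}$ ($\alpha\in\mathbb{C}$): $\{e_1,e_2\}=e_2$, $\{e_1,e_3\}=\alpha e_3$; $\mathcal{P}_{3,5}$: $\{e_1,e_2\}=e_3$, $\{e_1,e_3\}=-2e_1$, $\{e_2,e_3\}=2e_2$; $\mathcal{P}_{3,6}$: $e_1\cdot e_1=e_2$, $e_1\cdot e_2=e_3$; $\mathcal{P}_{3,7}$: $e_1\cdot e_1=e_1$, $e_2\cdot e_2=e_2$, $e_3\cdot e_3=e_3$; $\mathcal{P}_{3,8}$: $e_1\cdot e_1=e_1$, $e_2\cdot e_2=e_2$, $e_2\cdot e_3=e_3$; $\mathcal{P}_{3,9}$: $e_1\cdot e_1=e_1$, $e_1\cdot e_2=e_2$, $e_1\cdot e_3=e_3$, $e_2\cdot e_2=e_3$; $\mathcal{P}_{3,10}$: $e_1\cdot e_1=e_1$, $e_2\cdot e_2=e_2$; $\mathcal{P}_{3,11}$: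 $e_1\cdot e_1=e_1$, $e_1\cdot e_2=e_2$; $\mathcal{P}_{3,12}$: $e_1\cdot e_1=e_1$, $e_2\cdot e_2=e_3$; $\mathcal{P}_{3,13}$: $e_1\cdot e_1=e_2$; $\mathcal{P}_{3,14}$: $e_1\cdot e_1=e_2$, $\{e_1,e_3\}=e_3$; $\mathcal{P}_{3,15}$: $e_1\cdot e_1=e_2$, $\{e_1,e_3\}=e_2$; $\mathcal{P}_{3,16}^{\alpha}$ ($\alpha\in\mathbb{C}$): $e_1\cdot e_2=e_3$, $\{e_1,e_2\}=\alpha e_3$; $\mathcal{P}_{3,17}$: $e_1\cdot e_1=e_1$, $e_1\cdot e_2=e_2$, $e_1\cdot e_3=e_3$; $\mathcal{P}_{3,18}$: $e_1\cdot e_1=e_1$, $e_1\cdot e_2=e_2$, $e_1\cdot e_3=e_3$, $\{e_2,e_3\}=e_2$; $\mathcal{P}_{3,19}$: $e_1\cdot e_1=e_1$; $\mathcal{P}_{3,20}$: $e_1\cdot e_1=e_1$, $\{e_2,e_3\}=e_2$. Between these algebras there are precisely the following isomorphisms: for $\alpha,\beta\neq 0$, $\mathcal{P}_{3,4}^{\alpha}\cong\mathcal{P}_{3,4}^{\beta}$ if and only if $\alpha=\beta$ or $\alpha=1/\beta$; and $\mathcal{P}_{3,16}^{\alpha}\cong\mathcal{P}_{3,16}^{\beta}$ if and only if $\alpha^2=\beta^2$.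
   Context: A Poisson algebra is a vector space $\mathcal{P}$ with a commutative associative product $\cdot$ and a Lie bracket $\{-,-\}$ satisfying the Leibniz identity $\{x\cdot y,z\}=\{x,z\}\cdot y+x\cdot\{y,z\}$ for all $x,y,z$. An isomorphism of Poisson algebras is a linear bijection preserving both products. *)

(* Defs.v *)
(* Complex numbers: C := R[i] (mathcomp-real-closed's
   complex) for an arbitrary R : realType, i.e. C is the field of complex
   numbers (R is a complete archimedean ordered field, hence the reals). *)
From HB Require Import structures.
From mathcomp Require Import all_boot all_order all_algebra.
From mathcomp Require Import complex reals.
Set Implicit Arguments. Unset Strict Implicit. Unset Printing Implicit Defensive.
Import Order.TTheory GRing.Theory Num.Theory.
Local Open Scope ring_scope.

Record is_poisson (K : fieldType) (V : lmodType K) (mul br : V -> V -> V) : Prop :=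
  { mul_linl : forall a x y z, mul (a *: x + y) z = a *: mul x z + mul y z;
    mul_linr : forall a x y z, mul z (a *: x + y) = a *: mul z x + mul z y;
    mul_comm : forall x y, mul x y = mul y x;
    mul_assoc : forall x y z, mul x (mul y z) = mul (mul x y) z;
    br_linl : forall a x y z, br (a *: x + y) z = a *: br x z + br y z;
    br_linr : forall a x y z, br z (a *: x + y) = a *: br z x + br z y;
    br_alt : forall x, br x x = 0;
    br_jacobi : forall x y z, br x (br y z) + br y (br z x) + br z (br x y) = 0;
    leibniz : forall x y z, br (mul x y) z = mul (br x z) y + mul x (br y z) }.

Definition poisson_iso (K : fieldType) (V W : lmodType K)
  (mulV brV : V -> V -> V) (mulW brW : W -> W -> W) : Prop :=
  exists f : V -> W,
    [/\ forall a x y, f (a *: x + y) = a *: f x + f y,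
        bijective f,
        forall x y, f (mulV x y) = mulW (f x) (f y)
      & forall x y, f (brV x y) = brW (f x) (f y)].

Inductive P3 (C : Type) : Type :=
  | P3_1 | P3_2 | P3_3 | P3_4 of C | P3_5 | P3_6 | P3_7 | P3_8 | P3_9 | P3_10
  | P3_11 | P3_12 | P3_13 | P3_14 | P3_15 | P3_16 of C | P3_17 | P3_18
  | P3_19 | P3_20.
Arguments P3_1 {C}. Arguments P3_2 {C}. Arguments P3_3 {C}. Arguments P3_5 {C}.
Arguments P3_6 {C}. Arguments P3_7 {C}. Arguments P3_8 {C}. Arguments P3_9 {C}.
Arguments P3_10 {C}. Arguments P3_11 {C}. Arguments P3_12 {C}. Arguments P3_13 {C}.
Arguments P3_14 {C}. Arguments P3_15 {C}. Arguments P3_17 {C}. Arguments P3_18 {C}.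
Arguments P3_19 {C}. Arguments P3_20 {C}.

Section Tables.
Variable C : fieldType.

(* A table entry (i, j, k, c) means: the product of e_(i+1) and e_(j+1)
   has coefficient c on e_(k+1) (basis indexed from 0). *)
Definition entry := (nat * nat * nat * C)%type.

Definition mk (i j k : nat) (c : C) : entry := (i, j, k, c).
Arguments mk i%_N j%_N k%_N c%_R.

Definition sc (l : seq entry) (i j k : nat) : C :=
  \sum_(t <- l) (if [&& t.1.1.1 == i, t.1.1.2 == j & t.1.2 == k] then t.2 else 0).

Definition mul_table (p : P3 C) : seq entry :=
  match p with
  | P3_6 => [:: (mk 0 0 1 1); (mk 0 1 2 1)]
  | P3_7 => [:: (mk 0 0 0 1); (mk 1 1 1 1); (mk 2 2 2 1)]
  | P3_8 => [:: (mk 0 0 0 1); (mk 1 1 1 1); (mk 1 2 2 1)]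
  | P3_9 => [:: (mk 0 0 0 1); (mk 0 1 1 1); (mk 0 2 2 1); (mk 1 1 2 1)]
  | P3_10 => [:: (mk 0 0 0 1); (mk 1 1 1 1)]
  | P3_11 => [:: (mk 0 0 0 1); (mk 0 1 1 1)]
  | P3_12 => [:: (mk 0 0 0 1); (mk 1 1 2 1)]
  | P3_13 => [:: (mk 0 0 1 1)]
  | P3_14 => [:: (mk 0 0 1 1)]
  | P3_15 => [:: (mk 0 0 1 1)]
  | P3_16 _ => [:: (mk 0 1 2 1)]
  | P3_17 => [:: (mk 0 0 0 1); (mk 0 1 1 1); (mk 0 2 2 1)]
  | P3_18 => [:: (mk 0 0 0 1); (mk 0 1 1 1); (mk 0 2 2 1)]
  | P3_19 => [:: (mk 0 0 0 1)]
  | P3_20 => [:: (mk 0 0 0 1)]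
  | _ => [::]
  end.

Definition br_table (p : P3 C) : seq entry :=
  match p with
  | P3_2 => [:: (mk 0 1 2 1)]
  | P3_3 => [:: (mk 0 1 1 1); (mk 0 2 1 1); (mk 0 2 2 1)]
  | P3_4 a => [:: (mk 0 1 1 1); (mk 0 2 2 a)]
  | P3_5 => [:: (mk 0 1 2 1); (mk 0 2 0 (-2)); (mk 1 2 1 2)]
  | P3_14 => [:: (mk 0 2 2 1)]
  | P3_15 => [:: (mk 0 2 1 1)]
  | P3_16 a => [:: (mk 0 1 2 a)]
  | P3_18 => [:: (mk 1 2 1 1)]
  | P3_20 => [:: (mk 1 2 1 1)]
  | _ => [::]
  end.

Definition mulT (p : P3 C) (i j k : nat) : C :=
  if (i <= j)%N then sc (mul_table p) i j k else sc (mul_table p) j i k.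
Definition brT (p : P3 C) (i j k : nat) : C :=
  if (i < j)%N then sc (br_table p) i j k
  else if (j < i)%N then - sc (br_table p) j i k else 0.

(* the bilinear extensions on C^3 = 'rV[C]_3, e_(i+1) = i-th unit row vector *)
Definition mulP (p : P3 C) (x y : 'rV[C]_3) : 'rV[C]_3 :=
  \row_(k < 3) \sum_(i < 3) \sum_(j < 3) x 0 i * y 0 j * mulT p i j k.
Definition brP (p : P3 C) (x y : 'rV[C]_3) : 'rV[C]_3 :=
  \row_(k < 3) \sum_(i < 3) \sum_(j < 3) x 0 i * y 0 j * brT p i j k.

Definition listed_iso (p q : P3 C) : Prop :=
  match p, q with
  | P3_4 a, P3_4 b => a != 0 /\ b != 0 /\ (a = b \/ a = b^-1) \/ a = b
  | P3_16 a, P3_16 b => a ^+ 2 = b ^+ 2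
  | _, _ => p = q
  end.

End Tables.

(* Main.v *)
(* In both the associative and the Lie part the classification is driven by
   eigenvalues. Fitting's lemma for multiplication by an element shows that the product
   either has a nonzero idempotent e or is nilpotent of index at most 4 on every element.
   In the first case the Leibniz rule makes e central for the bracket and splits the
   algebra as a product of its Peirce pieces, which are handled according to the rank of e.
   In the second case the powers of a single element, or the symmetric form that the
   product induces when all cubes vanish, determine the product, and the Leibniz rule
   leaves at most one bracket parameter. If the product is zero, a Lie algebra is left:
   either some ad h has a nonzero eigenvalue and the Jacobi identity gives the solvable
   family or sl2, or the algebra is abelian or Heisenberg. The listed algebras are told
   apart by isomorphism invariant properties of the two products. *)
Require Import Defs.
From HB Require Import structures.
From mathcomp Require Import all_boot all_order all_algebra.
From mathcomp Require Import complex reals.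
From mathcomp Require Import boolp ring spectral.
Import Order.TTheory GRing.Theory Num.Theory.
Set Implicit Arguments. Unset Strict Implicit. Unset Printing Implicit Defensive.
Local Open Scope ring_scope.

(** * Coordinates and bases *)

(** Everything takes place in ['rV_3], where a basis is a triple with nonzero explicit determinant.
    An isomorphism then amounts to nine products and brackets of basis vectors, and the remaining
    identities are polynomial. The idempotent found by Fitting lies in the span of the powers of the
    chosen element. This makes the dichotomy usable a second time: for an element of the annihilator
    of [e], or of an ideal complementary to [e], the new idempotent stays there. Algebraic
    closedness enters only through square roots (a quadratic eigenvalue equation, isotropic vectors
    of a binary form, the splitting of a quadratic algebra) and through one eigenvalue of a
    multiplication. Characteristic zero enters through polarisation and through the factors 2
    produced by Leibniz on squares. The parameter of [P3_4] is a ratio of two eigenvalues of one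
    inner derivation, so it is seen only up to inversion; that of [P3_16] is a ratio of bracket to
    product on two isotropic lines, whose order fixes the sign. *)

Ltac vring := apply/rowP => ?; rewrite ?mxE; ring.
Ltac vfield := apply/rowP => ?; rewrite ?mxE; field.
Ltac table := rewrite /mulT /brT /sc /= ?(big_cons, big_nil) /=.

Section Coordinates.
Variable K : fieldType.
Local Notation vec := 'rV[K]_3.

Definition i0 : 'I_3 := @Ordinal 3 0 isT.
Definition i1 : 'I_3 := @Ordinal 3 1 isT.
Definition i2 : 'I_3 := @Ordinal 3 2 isT.

Lemma sum3 (V : zmodType) (F : 'I_3 -> V) : \sum_(i < 3) F i = F i0 + F i1 + F i2.
Proof.
rewrite !big_ord_recr big_ord0 /= add0r.
by do 2?[congr (_ + _)]; congr F; apply: val_inj.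
Qed.

Lemma ord3P (P : 'I_3 -> Prop) : P i0 -> P i1 -> P i2 -> forall k, P k.
Proof.
move=> P0 P1 P2 [[|[|[|//]]] k3];
  [rewrite (_ : Ordinal k3 = i0)|rewrite (_ : Ordinal k3 = i1)
  |rewrite (_ : Ordinal k3 = i2)] => //; exact: val_inj.
Qed.

Lemma row3P (x y : vec) :
  x 0 i0 = y 0 i0 -> x 0 i1 = y 0 i1 -> x 0 i2 = y 0 i2 -> x = y.
Proof. by move=> *; apply/rowP; apply: ord3P. Qed.

Definition v3 (a b c : K) : vec := \row_k nth 0 [:: a; b; c] k.

(** Closed forms of the table products: with them every identity in a listed algebra becomes a
    polynomial identity in coordinates, within reach of [ring]. *)
Definition mul_coords (p : P3 K) (x0 x1 x2 y0 y1 y2 : K) : vec :=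
  match p with
  | P3_6 => v3 0 (x0 * y0) (x0 * y1 + x1 * y0)
  | P3_7 => v3 (x0 * y0) (x1 * y1) (x2 * y2)
  | P3_8 => v3 (x0 * y0) (x1 * y1) (x1 * y2 + x2 * y1)
  | P3_9 => v3 (x0 * y0) (x0 * y1 + x1 * y0) (x0 * y2 + x2 * y0 + x1 * y1)
  | P3_10 => v3 (x0 * y0) (x1 * y1) 0
  | P3_11 => v3 (x0 * y0) (x0 * y1 + x1 * y0) 0
  | P3_12 => v3 (x0 * y0) 0 (x1 * y1)
  | P3_13 | P3_14 | P3_15 => v3 0 (x0 * y0) 0
  | P3_16 _ => v3 0 0 (x0 * y1 + x1 * y0)
  | P3_17 | P3_18 =>
      v3 (x0 * y0) (x0 * y1 + x1 * y0) (x0 * y2 + x2 * y0)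
  | P3_19 | P3_20 => v3 (x0 * y0) 0 0
  | _ => v3 0 0 0
  end.

Definition br_coords (p : P3 K) (x0 x1 x2 y0 y1 y2 : K) : vec :=
  match p with
  | P3_2 => v3 0 0 (x0 * y1 - x1 * y0)
  | P3_3 => v3 0 (x0 * y1 - x1 * y0 + (x0 * y2 - x2 * y0)) (x0 * y2 - x2 * y0)
  | P3_4 a => v3 0 (x0 * y1 - x1 * y0) (a * (x0 * y2 - x2 * y0))
  | P3_5 => v3 (- 2 * (x0 * y2 - x2 * y0)) (2 * (x1 * y2 - x2 * y1))
               (x0 * y1 - x1 * y0)
  | P3_14 => v3 0 0 (x0 * y2 - x2 * y0)
  | P3_15 => v3 0 (x0 * y2 - x2 * y0) 0
  | P3_16 a => v3 0 0 (a * (x0 * y1 - x1 * y0))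
  | P3_18 | P3_20 => v3 0 (x1 * y2 - x2 * y1) 0
  | _ => v3 0 0 0
  end.

Lemma mulTC (p : P3 K) i j k : mulT p i j k = mulT p j i k.
Proof. by rewrite /mulT; case: ltngtP => // ->. Qed.
Lemma brTC (p : P3 K) i j k : brT p i j k = - brT p j i k.
Proof. by rewrite /brT; case: ltngtP; rewrite ?opprK ?oppr0. Qed.
Lemma brTii (p : P3 K) i k : brT p i i k = 0.
Proof. by rewrite /brT ltnn. Qed.

Lemma mulPE p x y : mulP p x y =
  mul_coords p (x 0 i0) (x 0 i1) (x 0 i2) (y 0 i0) (y 0 i1) (y 0 i2).
Proof.
by case: p => [|||a||||||||||||a||||]; apply: row3P;
  rewrite /mulP !mxE !sum3 /mulT /sc /= !(big_cons, big_nil) /= ?mxE /=; ring.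
Qed.

Lemma brPE p x y : brP p x y =
  br_coords p (x 0 i0) (x 0 i1) (x 0 i2) (y 0 i0) (y 0 i1) (y 0 i2).
Proof.
by case: p => [|||a||||||||||||a||||]; apply: row3P;
  rewrite /brP !mxE !sum3 /brT /sc /= !(big_cons, big_nil) /= ?mxE /=; ring.
Qed.

Lemma P3_poisson (p : P3 K) : is_poisson (mulP p) (brP p).
Proof.
split; case: p => [|||a||||||||||||a||||] *; rewrite !(mulPE, brPE) /=; apply: row3P;
  rewrite !mxE /=; ring.
Qed.
End Coordinates.

(** * Isomorphisms and transport to row vectors *)

Section Isomorphisms.
Import VectorInternalTheory.
Variable K : fieldType.

Lemma poisson_iso_sym (V W : lmodType K) mV bV mW bW :
  @poisson_iso K V W mV bV mW bW -> poisson_iso mW bW mV bV.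
Proof.
move=> [f [flin [g fK gK] fm fb]]; exists g; split.
- by move=> a x y; rewrite -{1}[x]gK -{1}[y]gK -flin fK.
- by exists f.
- by move=> x y; rewrite -{1}[x]gK -{1}[y]gK -fm fK.
- by move=> x y; rewrite -{1}[x]gK -{1}[y]gK -fb fK.
Qed.

Lemma poisson_iso_trans (V W U : lmodType K) mV bV mW bW mU bU :
  @poisson_iso K V W mV bV mW bW -> @poisson_iso K W U mW bW mU bU ->
  poisson_iso mV bV mU bU.
Proof.
move=> [f [flin fbij fm fb]] [g [glin gbij gm gb]]; exists (g \o f); split.
- by move=> a x y /=; rewrite flin glin.
- exact: bij_comp.
- by move=> x y /=; rewrite fm gm.
- by move=> x y /=; rewrite fb gb.
Qed.

Lemma poisson_coordinates (V : vectType K) m b :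
  \dim (fullv : {vspace V}) = 3%N -> @is_poisson K V m b ->
  exists m' b', @is_poisson K 'rV[K]_3 m' b' /\ poisson_iso m b m' b'.
Proof.
rewrite dimvf => dimV P.
(* [v2r] lands in rows of length [dim V]; stating the existence for length 3 and rewriting with
   [dimV] inside it avoids a cast. *)
have [f [g [flin glin fK gK]]] : exists (f : V -> 'rV[K]_3) (g : 'rV[K]_3 -> V),
  [/\ linear f, linear g, cancel f g & cancel g f].
  rewrite -dimV; exists v2r, r2v; split.
  - exact: linearP. - exact: linearP. - exact: v2rK. - exact: r2vK.
have f0 : f 0 = 0 by have := flin (-1) 0 0; rewrite !scaleN1r oppr0 addr0 addNr.
have fD x y : f (x + y) = f x + f y by have := flin 1 x y; rewrite !scale1r.
exists (fun x y => f (m (g x) (g y))), (fun x y => f (b (g x) (g y))); split; last first.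
  exists f; split=> //; first by exists g.
  - by move=> x y; rewrite !fK.
  - by move=> x y; rewrite !fK.
split=> *; rewrite ?glin.
- by rewrite (mul_linl P) flin.
- by rewrite (mul_linr P) flin.
- by rewrite (mul_comm P).
- by rewrite !fK (mul_assoc P).
- by rewrite (br_linl P) flin.
- by rewrite (br_linr P) flin.
- by rewrite (br_alt P).
- by rewrite !fK -!fD (br_jacobi P).
- by rewrite !fK -!fD (leibniz P).
Qed.
End Isomorphisms.

(** * Bases detected by an explicit determinant *)

Section Determinant.
Variable K : fieldType.
Implicit Types x y z u v : 'rV[K]_3.

Definition det3 x y z : K :=
  x 0 i0 * (y 0 i1 * z 0 i2 - y 0 i2 * z 0 i1)
  - x 0 i1 * (y 0 i0 * z 0 i2 - y 0 i2 * z 0 i0)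
  + x 0 i2 * (y 0 i0 * z 0 i1 - y 0 i1 * z 0 i0).

(** Cramer's rule: once the denominator is cleared, it is a polynomial identity. *)
Lemma det3_coordinates x y z v : det3 x y z != 0 ->
  v = (det3 v y z / det3 x y z) *: x + (det3 x v z / det3 x y z) *: y
      + (det3 x y v / det3 x y z) *: z.
Proof.
move=> D0; apply: (scalerI D0); rewrite !scalerDr !scalerA.
have e t : det3 x y z * (t / det3 x y z) = t by rewrite mulrC divfK.
rewrite !e.
by apply: row3P; rewrite /det3 !mxE; ring.
Qed.

Lemma det3_span x y z v : det3 x y z != 0 ->
  exists a b c, v = a *: x + b *: y + c *: z.
Proof.
move=> D0; exists (det3 v y z / det3 x y z), (det3 x v z / det3 x y z),
  (det3 x y v / det3 x y z); exact: det3_coordinates.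
Qed.

(** By multilinearity each coefficient times the determinant is the determinant in which one row is
    replaced by the vanishing combination. *)
Lemma det3_free x y z a b c : det3 x y z != 0 ->
  a *: x + b *: y + c *: z = 0 -> [/\ a = 0, b = 0 & c = 0].
Proof.
move=> D0 eq0; have e k : a * x 0 k + b * y 0 k + c * z 0 k = 0.
  by have /rowP/(_ k) := eq0; rewrite !mxE.
split; apply: (mulIf D0); rewrite mul0r.
- transitivity (det3 (\row_k (a * x 0 k + b * y 0 k + c * z 0 k)) y z).
    by rewrite /det3 !mxE; ring.
  by rewrite /det3 !mxE !e; ring.
- transitivity (det3 x (\row_k (a * x 0 k + b * y 0 k + c * z 0 k)) z).
    by rewrite /det3 !mxE; ring.
  by rewrite /det3 !mxE !e; ring.
- transitivity (det3 x y (\row_k (a * x 0 k + b * y 0 k + c * z 0 k))).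
    by rewrite /det3 !mxE; ring.
  by rewrite /det3 !mxE !e; ring.
Qed.

(** If no [z] works, testing against the unit vectors makes all 2 by 2 minors of [x], [y] vanish.
    Then [y_k x - x_k y = 0] for every [k], so independence forces each [x_k], hence [x], to be
    zero, which is itself a relation. *)
Lemma det3_complete x y :
  (forall a b, a *: x + b *: y = 0 -> a = 0 /\ b = 0) -> exists z, det3 x y z != 0.
Proof.
move=> indep; apply: contrapT => none.
have D0 z : det3 x y z = 0 by apply/eqP/negP => /negP nz; apply: none; exists z.
have e12 : x 0 i1 * y 0 i2 = x 0 i2 * y 0 i1.
  by apply: subr0_eq; rewrite -(D0 (v3 1 0 0)) /det3 !mxE /=; ring.
have e02 : x 0 i0 * y 0 i2 = x 0 i2 * y 0 i0.
  by apply: subr0_eq; rewrite -[RHS]oppr0 -(D0 (v3 0 1 0)) /det3 !mxE /=; ring.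
have e01 : x 0 i0 * y 0 i1 = x 0 i1 * y 0 i0.
  by apply: subr0_eq; rewrite -(D0 (v3 0 0 1)) /det3 !mxE /=; ring.
have e : forall j k, x 0 j * y 0 k = x 0 k * y 0 j.
  by apply: ord3P; apply: ord3P.
have xk k : x 0 k = 0.
  have h : y 0 k *: x - x 0 k *: y = 0.
    by apply/rowP => j; rewrite !mxE [y 0 k * _]mulrC (e j k) subrr.
  by move: h; rewrite -scaleNr => /indep[_ /eqP]; rewrite oppr_eq0 => /eqP.
have x0 : 1 *: x + 0 *: y = 0 by apply/rowP => k; rewrite !mxE xk; ring.
by have [/eqP] := indep _ _ x0; rewrite oner_eq0.
Qed.

(** If [t] completes [x], [y] to a basis, the determinant is that of [x], [y], [t] times the
    [t]-coordinate of [z]; a zero coordinate would make [z] dependent on [x] and [y]. *)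
Lemma det3_neq0 x y z :
  (forall a b c, a *: x + b *: y + c *: z = 0 -> [/\ a = 0, b = 0 & c = 0]) ->
  det3 x y z != 0.
Proof.
move=> indep; have [|t Dt] := @det3_complete x y.
  by move=> a b eq0; have [|-> ->] := indep a b 0; rewrite ?scale0r ?addr0.
have [a [b [d ez]]] := det3_span z Dt.
rewrite ez (_ : det3 _ _ _ = d * det3 x y t); last by rewrite /det3 !mxE; ring.
rewrite mulf_neq0 //; apply/eqP => d0; move: ez; rewrite d0 scale0r addr0 => ez.
have [|_ _ /eqP] := indep a b (-1); first by rewrite ez scaleN1r subrr.
by rewrite oppr_eq0 oner_eq0.
Qed.
End Determinant.

Section Basis.
Variable K : fieldType.
Variables m b : 'rV[K]_3 -> 'rV[K]_3 -> 'rV[K]_3.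
Hypothesis P : is_poisson m b.
Implicit Types x y z : 'rV[K]_3.

Lemma pmulDl x y z : m (x + y) z = m x z + m y z.
Proof. by have := mul_linl P 1 x y z; rewrite !scale1r. Qed.
Lemma pmulDr x y z : m z (x + y) = m z x + m z y.
Proof. by have := mul_linr P 1 x y z; rewrite !scale1r. Qed.
Lemma pmul0l z : m 0 z = 0.
Proof. by have := mul_linl P (-1) 0 0 z; rewrite !scaleN1r oppr0 addr0 addNr. Qed.
Lemma pmul0r z : m z 0 = 0.
Proof. by rewrite (mul_comm P) pmul0l. Qed.
Lemma pmulZl a x z : m (a *: x) z = a *: m x z.
Proof. by have := mul_linl P a x 0 z; rewrite pmul0l !addr0. Qed.
Lemma pmulZr a x z : m z (a *: x) = a *: m z x.
Proof. by rewrite !(mul_comm P z) pmulZl. Qed.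
Lemma pmulNl x z : m (- x) z = - m x z.
Proof. by rewrite -scaleN1r pmulZl scaleN1r. Qed.
Lemma pmulNr x z : m z (- x) = - m z x.
Proof. by rewrite !(mul_comm P z) pmulNl. Qed.
Lemma pbrDl x y z : b (x + y) z = b x z + b y z.
Proof. by have := br_linl P 1 x y z; rewrite !scale1r. Qed.
Lemma pbrDr x y z : b z (x + y) = b z x + b z y.
Proof. by have := br_linr P 1 x y z; rewrite !scale1r. Qed.
Lemma pbr0l z : b 0 z = 0.
Proof. by have := br_linl P (-1) 0 0 z; rewrite !scaleN1r oppr0 addr0 addNr. Qed.
Lemma pbr0r z : b z 0 = 0.
Proof. by have := br_linr P (-1) 0 0 z; rewrite !scaleN1r oppr0 addr0 addNr. Qed.
Lemma pbrZl a x z : b (a *: x) z = a *: b x z.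
Proof. by have := br_linl P a x 0 z; rewrite pbr0l !addr0. Qed.
Lemma pbrZr a x z : b z (a *: x) = a *: b z x.
Proof. by have := br_linr P a x 0 z; rewrite pbr0r !addr0. Qed.
Lemma pbrNl x z : b (- x) z = - b x z.
Proof. by rewrite -scaleN1r pbrZl scaleN1r. Qed.
Lemma pbrNr x z : b z (- x) = - b z x.
Proof. by rewrite -scaleN1r pbrZr scaleN1r. Qed.
Lemma pbrC x y : b x y = - b y x.
Proof.
apply/eqP; rewrite -addr_eq0; apply/eqP.
by have := br_alt P (x + y); rewrite pbrDl !pbrDr !(br_alt P) add0r addr0.
Qed.

Definition bilinE :=
  (pmulDl, pmulDr, pmulZl, pmulZr, pmulNl, pmulNr, pmul0l, pmul0r,
   pbrDl, pbrDr, pbrZl, pbrZr, pbrNl, pbrNr, pbr0l, pbr0r).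

(** The map is built from the table algebra to [m], [b], sending a row to its combination of [e1],
    [e2], [e3]: in this direction both operations expand by bilinearity, and Cramer's rule gives the
    inverse. *)
Lemma iso_of_basis (p : P3 K) e1 e2 e3 : det3 e1 e2 e3 != 0 ->
  let M i j := mulT p i j 0 *: e1 + mulT p i j 1 *: e2 + mulT p i j 2 *: e3 in
  let B i j := brT p i j 0 *: e1 + brT p i j 1 *: e2 + brT p i j 2 *: e3 in
  [/\ m e1 e1 = M 0 0, m e1 e2 = M 0 1 & m e1 e3 = M 0 2]%N ->
  [/\ m e2 e2 = M 1 1, m e2 e3 = M 1 2 & m e3 e3 = M 2 2]%N ->
  [/\ b e1 e2 = B 0 1, b e1 e3 = B 0 2 & b e2 e3 = B 1 2]%N ->
  poisson_iso m b (mulP p) (brP p).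
Proof.
move=> D0 M B [m11 m12 m13] [m22 m23 m33] [b12 b13 b23].
apply: poisson_iso_sym.
have D0' := mulfV D0.
pose g (r : 'rV[K]_3) := r 0 i0 *: e1 + r 0 i1 *: e2 + r 0 i2 *: e3.
pose f v := v3 (det3 v e2 e3 / det3 e1 e2 e3) (det3 e1 v e3 / det3 e1 e2 e3)
               (det3 e1 e2 v / det3 e1 e2 e3).
have fK : cancel f g.
  by move=> v; rewrite /g /f !mxE /= -det3_coordinates.
exists g; split.
- by move=> a x y; apply/rowP => k; rewrite !mxE; ring.
- exists f => // r; apply: row3P; rewrite /f !mxE /= -[RHS]mulr1 -D0' mulrA;
    congr (_ / _); rewrite /det3 !mxE; ring.
- move=> x y; rewrite /g !bilinE (mul_comm P e2 e1) (mul_comm P e3 e1) (mul_comm P e3 e2).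
  rewrite m11 m12 m13 m22 m23 m33 /M /mulP !mxE !sum3 /=.
  rewrite !(mulTC p 1 0) !(mulTC p 2 0) !(mulTC p 2 1).
  by apply/rowP => k; rewrite !mxE; ring.
- move=> x y; rewrite /g !bilinE (pbrC e2 e1) (pbrC e3 e1) (pbrC e3 e2) !(br_alt P).
  rewrite b12 b13 b23 /B /brP !mxE !sum3 /=.
  rewrite !(brTC p 1 0) !(brTC p 2 0) !(brTC p 2 1) !brTii.
  by apply/rowP => k; rewrite !mxE; ring.
Qed.
End Basis.

(** * Idempotents from the Fitting decomposition *)

Section Fitting.
Variable K : fieldType.
Variables m b : 'rV[K]_3 -> 'rV[K]_3 -> 'rV[K]_3.
Hypothesis P : is_poisson m b.
Implicit Types x y z v : 'rV[K]_3.
Local Notation vec := 'rV[K]_3.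

(** Membership in the span of the powers [x], [x^2], ...; quantifying over predicates lets it be
    applied directly to an annihilator or to a plane. *)
Definition in_subalgebra x y := forall S : vec -> Prop,
  (forall a u v, S u -> S v -> S (a *: u + v)) -> (forall u, S u -> S (m x u)) ->
  S x -> S y.

Definition mulmat x : 'M[K]_3 := \matrix_(i, j) m x (delta_mx 0 i) 0 j.

Lemma mulmatE x v : v *m mulmat x = m x v.
Proof.
rewrite mulmx_sum_row sum3 [in RHS](row_sum_delta v) sum3 !(bilinE P).
by congr (_ + _ + _); congr (_ *: _); apply/rowP => j; rewrite !mxE.
Qed.

Definition act x (p : {poly K}) v := v *m horner_mx (mulmat x) p.

Lemma actM x p q v : act x (p * q) v = act x q (act x p v).
Proof. by rewrite /act rmorphM /= -mulmxE mulmxA. Qed.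
Lemma actD x p q v : act x (p + q) v = act x p v + act x q v.
Proof. by rewrite /act rmorphD mulmxDr. Qed.
Lemma act1 x v : act x 1 v = v.
Proof. by rewrite /act rmorph1 mulmx1. Qed.
Lemma actX x v : act x 'X v = m x v.
Proof. by rewrite /act horner_mx_X mulmatE. Qed.
Lemma actC x c v : act x c%:P v = c *: v.
Proof. by rewrite /act horner_mx_C mul_mx_scalar. Qed.

(** Multiplication by [x] commutes with multiplication by [w], hence so does every polynomial in it.
    Multiplication by an element [act x p x] is therefore again a polynomial in multiplication by
    [x]. *)
Lemma act_mul x p v w : m (act x p v) w = act x p (m v w).
Proof.
elim/poly_ind: p => [|p c IH]; first by rewrite /act rmorph0 !mulmx0 (pmul0l P).
by rewrite !actD !actM !actX !actC (pmulDl P) (pmulZl P) -(mul_assoc P) IH.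
Qed.

Lemma act_in_subalgebra x p : in_subalgebra x (act x p x).
Proof.
move=> S Slin Sm Sx; elim/poly_ind: p => [|p c IH].
  by have := Slin (-1) _ _ Sx Sx; rewrite scaleN1r addNr /act rmorph0 mulmx0.
by rewrite actD actM actX actC addrC; apply: Slin => //; apply: Sm.
Qed.

(* Fitting: write the characteristic polynomial of multiplication by [x] as
   [q * 'X^k] with [q] prime to ['X]; a Bezout relation
   [u * 'X^k.+1 + w * q = 1] yields the idempotent [u(x) x^k.+1]. *)
Lemma nilpotent_or_idempotent x :
  m x (m x (m x x)) = 0 \/ exists f, [/\ f != 0, m f f = f & in_subalgebra x f].
Proof.
pose p := char_poly (mulmat x).
have p0 : p != 0 by rewrite monic_neq0 // char_poly_monic.
have pE v : act x p v = 0 by rewrite /act Cayley_Hamilton mulmx0.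
have [k [q]] := multiplicity_XsubC p 0.
rewrite p0 subr0 /= => q0 pq.
have qn0 : q != 0 by apply: contraNneq q0 => ->; exact: root0.
have k3 : (k <= 3)%N.
  have : size p = 4%N by rewrite size_char_poly.
  by rewrite pq size_mulXn // => s4; rewrite -ltnS -s4 -[X in (X < _)%N]addn0
    ltn_add2l size_poly_gt0.
have : coprimep ('X ^+ k.+1) q.
  by rewrite coprimep_expl // coprimep_sym -['X]subr0 coprimep_XsubC.
move=> /Bezout_eq1_coprimepP[[u w] /= uw].
(* The algebra may lack a unit, so the polynomial is applied to [x] itself. This supplies the last
   power: multiplication by [e] is [u * 'X^k.+1], also when [k = 0]. *)
pose e := act x (u * 'X^k) x.
have eE v : m e v = act x (u * 'X^(k.+1)) v.
  by rewrite act_mul -(actX x v) -actM exprS mulrCA.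
have eD v : v = m e v + act x (w * q) v by rewrite eE -actD uw act1.
have [e0|en0] := eqVneq e 0; [left|right; exists e; split=> //].
(* With [e = 0] the factor [w * q] acts as the identity, so ['X^k] acts as [w * p], which is zero by
   Cayley-Hamilton; and [k <= 3]. *)
- have vE v : v = act x (w * q) v by rewrite {1}[v]eD e0 (pmul0l P) add0r.
  have X3 v : m x (m x (m x v)) = act x ('X^k * 'X^(3 - k)) v.
    by rewrite -exprD subnKC // !exprS expr0 mulr1 !actM !actX.
  by rewrite X3 actM [act x 'X^k _]vE -(actM x 'X^k) mulrCA (mulrC _ q) -pq
    (actM x w p) pE /act mul0mx.
(* It remains that [w * q] kills [e]: since [e] is [u * 'X^k] applied to [x], a multiple of [p]
   appears. *)
- rewrite [RHS]eD -[LHS]addr0; congr (_ + _).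
  have -> : e = act x (u * 'X^k) x by [].
  rewrite -actM (_ : _ * _ = p * (u * w)) ?actM ?pE /act ?mul0mx //.
  by rewrite pq; ring.
- exact: act_in_subalgebra.
Qed.
End Fitting.

(** * Zero product: Lie algebras *)

Section Lie.
Variable K : numClosedFieldType.
Variables m b : 'rV[K]_3 -> 'rV[K]_3 -> 'rV[K]_3.
Hypothesis P : is_poisson m b.
Hypothesis m0 : forall x y, m x y = 0.
Implicit Types u v w x y z h : 'rV[K]_3.

Let listed := exists p : P3 K, poisson_iso m b (mulP p) (brP p).

Lemma lie_iso (p : P3 K) e1 e2 e3 : mul_table p = [::] -> det3 e1 e2 e3 != 0 ->
  let B i j := brT p i j 0 *: e1 + brT p i j 1 *: e2 + brT p i j 2 *: e3 in
  [/\ b e1 e2 = B 0 1, b e1 e3 = B 0 2 & b e2 e3 = B 1 2]%N ->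
  poisson_iso m b (mulP p) (brP p).
Proof.
move=> p0 D0 B eB; apply: (iso_of_basis P D0) => //;
  by rewrite !m0 /mulT /sc p0 /= !big_nil !scale0r !addr0.
Qed.

(* Completing [h, x] to a basis [h, x, y], the Jacobi identity leaves [b x y] without
   [y]-component and, with [c] the [y]-component of [b h y] and [p] the [h]-component
   of [b x y], gives [(c + 1) * p = 0]; the case [p != 0] is sl2. *)
Lemma lie_eigen h x : x != 0 -> b h x = x -> listed.
Proof.
move=> x0 hx.
have h0 : h != 0 by apply: contraNneq x0 => h0; rewrite -hx h0 (pbr0l P).
have [|y D0] := @det3_complete _ h x.
  move=> a c eq0; have c0 : c *: x = 0.
    by rewrite -(pbr0r P h) -eq0 (pbrDr P) !(pbrZr P) hx (br_alt P) scaler0 add0r.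
  move: eq0; rewrite c0 addr0 => /eqP; rewrite scaler_eq0 (negPf h0) orbF => /eqP ->.
  by split=> //; move/eqP: c0; rewrite scaler_eq0 (negPf x0) orbF => /eqP.
have [a [be [c hy]]] := det3_span (b h y) D0.
have [p [q [r xy]]] := det3_span (b x y) D0.
have xh : b x h = - x by rewrite (pbrC P) hx.
have yh : b y h = - (a *: h + be *: x + c *: y) by rewrite (pbrC P) hy.
have yx : b y x = - (p *: h + q *: x + r *: y) by rewrite (pbrC P) xy.
have [] := @det3_free _ h x y (r * a - c * p - p) (r * be + a - c * q) (- r) D0.
  rewrite -[RHS](br_jacobi P h x y) hx xy yh !(bilinE P) xh hx hy xy yx.
  by rewrite !(br_alt P); vring.
move=> e1 e2 /eqP; rewrite oppr_eq0 => /eqP r0; subst r.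
have {e2}ea : a = c * q by apply: subr0_eq; rewrite -e2; ring.
subst a; have {e1} : (c + 1) * p = 0 by rewrite -[RHS]oppr0 -e1; ring.
have table3 := (hx, hy, xy, xh, yh, yx, br_alt P).
have [p0 _|p0] := eqVneq p 0; last first.
  move/eqP; rewrite mulf_eq0 (negPf p0) orbF addr_eq0 => /eqP ec; subst c.
  (* The corrections [q h] and [- (be / 2) x] turn [y] into an eigenvector of [b h] for [-1]; its
     bracket with [x] is [p h], so the factor [2 / p] yields [2 h]. *)
  exists P3_5; apply: (@lie_iso _ x ((2 / p) *: (y + q *: h - (be / 2) *: x)) (2 *: h)) => //.
    have -> : det3 x ((2 / p) *: (y + q *: h - (be / 2) *: x)) (2 *: h) = 4 / p * det3 h x y.
      by rewrite /det3 !mxE; field.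
    by rewrite !mulf_neq0 ?invr_neq0 ?pnatr_eq0.
  by table; rewrite !(bilinE P) !table3; split; vfield.
(* Now [x] and [y1] span an abelian ideal on which [b h] is triangular with eigenvalues 1 and [c].
   It is diagonalisable ([P3_4]) unless [c = 1] and [be] is nonzero, a Jordan block ([P3_3]). *)
subst p; pose y1 := y + q *: h.
have D1 : det3 h x y1 != 0 by rewrite (_ : det3 h x y1 = det3 h x y) // /det3 !mxE; ring.
have hy1 : b h y1 = be *: x + c *: y1 by rewrite /y1 !(bilinE P) !table3; vring.
have xy1 : b x y1 = 0 by rewrite /y1 !(bilinE P) !table3; vring.
clearbody y1; have [c1|c1] := eqVneq c 1; last first.
  exists (P3_4 c); apply: (@lie_iso _ h x (y1 + (be / (c - 1)) *: x)) => //.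
    by rewrite (_ : det3 h x _ = det3 h x y1) // /det3 !mxE; ring.
  table; rewrite !(bilinE P) hx hy1 xy1 !(br_alt P).
  by split; vfield; rewrite subr_eq0.
subst c; have [be0|be0] := eqVneq be 0.
  exists (P3_4 1); apply: (@lie_iso _ h x y1) => //.
  by table; rewrite hx hy1 xy1 be0; split; vring.
exists P3_3; apply: (@lie_iso _ h (be *: x) y1) => //.
  rewrite (_ : det3 _ _ _ = be * det3 h x y1) ?mulf_neq0 //.
  by rewrite /det3 !mxE; ring.
by table; rewrite !(bilinE P) hx hy1 xy1; split; vring.
Qed.

(* With [w = b u v] and [b u w = a u + be v + c w], a nonzero root [l] of
   ['X^2 - c 'X - be] makes [(l - c) v + w + (a / l) u] an eigenvector of [b u]. *)
Lemma heisenberg_step u v :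
  (forall h x, b h x = x -> x = 0) ->
  det3 u v (b u v) != 0 -> b u (b u v) = 0.
Proof.
move=> noeig; have [w uv] : exists w, b u v = w by eexists.
rewrite uv => D0.
have {}noeig h x l : l != 0 -> b h x = l *: x -> x = 0.
  move=> l0 hx; apply: (noeig (l^-1 *: h)).
  by rewrite (pbrZl P) hx scalerA mulVf // scale1r.
have [a [be [c uw]]] := det3_span (b u w) D0.
(* The candidate eigenvectors are nonzero because their [w]-coordinate is 1. *)
have wn0 l g : (l - c) *: v + w + g *: u != 0.
  apply/eqP => z0; have [] := @det3_free _ u v w g (l - c) 1 D0; last first.
    by move=> _ _ /eqP; rewrite oner_eq0.
  by rewrite -[RHS]z0; vring.
have noroot l : l != 0 -> l ^+ 2 = c * l + be -> False.
  move=> l0 el; have /eqP := wn0 l (a / l); apply.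
  apply: (noeig u _ _ l0).
  rewrite !(bilinE P) uv uw (br_alt P).
  have -> : be = l ^+ 2 - c * l by rewrite el; ring.
  by vfield.
have be0 : be = 0.
  apply/eqP/negP => /negP be0; pose s := sqrtC (c ^+ 2 + 4 * be).
  have sE : s ^+ 2 = c ^+ 2 + 4 * be by rewrite sqrtCK.
  have eE : ((c + s) / 2) ^+ 2 = c * ((c + s) / 2) + be.
    have -> : be = (s ^+ 2 - c ^+ 2) / 4 by rewrite sE; field.
    by field.
  apply: (noroot _ _ eE); apply: contraNneq be0 => l0; move: eE.
  by rewrite l0 mulr0 add0r expr0n /= => <-.
have c0 : c = 0.
  by apply/eqP/negP => /negP c0; apply: (noroot c) => //; rewrite be0 addr0.
(* What is left is [b u w = a u]; for nonzero [a] this makes [u] an eigenvector of [b w] for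
   [-a]. *)
move: uw; rewrite be0 c0 !scale0r !addr0 => uw; 
have [a0|a0] := eqVneq a 0; first by rewrite uw a0 scale0r.
have u0 : u = 0.
  apply: (noeig w u (- a)); first by rewrite oppr_eq0.
  by rewrite (pbrC P) uw scaleNr.
by rewrite u0 (pbr0l P).
Qed.

Lemma lie_noeigen : (forall h x, b h x = x -> x = 0) -> listed.
Proof.
move=> noeig; have [b0|] := pselect (forall x y, b x y = 0).
  exists P3_1; apply: (@lie_iso _ (v3 1 0 0) (v3 0 1 0) (v3 0 0 1)) => //.
    by rewrite /det3 !mxE /= !(mulr0, mul0r, mulr1, subr0, addr0) oner_neq0.
  by table; rewrite !b0; split; vring.
move=> /existsNP[u /existsNP[v /eqP]].
have [w uvw] : exists w, b u v = w by eexists.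
rewrite uvw => w0; have vuw : b v u = - w by rewrite (pbrC P) uvw.
have noeig' h x l : b h x = l *: x -> x != 0 -> l = 0.
  move=> hx; apply: contraNeq => l0; apply/eqP/(noeig (l^-1 *: h)).
  by rewrite (pbrZl P) hx scalerA mulVf // scale1r.
(* If [w] were [a u + c v], it would be an eigenvector of [b u] for [c] and of [b v] for [-a]; both
   coefficients would vanish, against [w] being nonzero. *)
have D0 : det3 u v w != 0.
  have [|z Dz] := @det3_complete _ u v.
    move=> a c eq0; have a0 : a *: w = 0.
      by rewrite -(pbr0l P v) -eq0 !(bilinE P) (br_alt P) uvw scaler0 addr0.
    have c0 : c *: w = 0.
      by rewrite -(pbr0r P u) -eq0 !(bilinE P) (br_alt P) uvw scaler0 add0r.
    by move: a0 c0 => /eqP; rewrite scaler_eq0 (negPf w0) orbF => /eqP -> /eqP;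
       rewrite scaler_eq0 (negPf w0) orbF => /eqP ->.
  have [a [c [d ew]]] := det3_span w Dz.
  rewrite ew (_ : det3 _ _ _ = d * det3 u v z); last by rewrite /det3 !mxE; ring.
  rewrite mulf_neq0 //; apply/eqP => d0; move: ew; rewrite d0 scale0r addr0 => ew.
  have c0 : c = 0.
    by apply: (noeig' u w) => //; rewrite {1}ew !(bilinE P) (br_alt P) uvw scaler0 add0r.
  have a0 : a = 0.
    apply/eqP; rewrite -oppr_eq0; apply/eqP; apply: (noeig' v w) => //.
    by rewrite {1}ew !(bilinE P) (br_alt P) vuw scaler0 addr0 scalerN scaleNr.
  by move: w0; rewrite ew a0 c0 !scale0r addr0 eqxx.
exists P3_2; apply: (@lie_iso _ u v w) => //; table.
have -> : b u w = 0 by rewrite -{1}uvw; apply: heisenberg_step; rewrite ?uvw.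
have -> : b v w = 0.
  apply/eqP; rewrite -oppr_eq0 -(pbrNr P) -vuw; apply/eqP.
  apply: heisenberg_step => //; rewrite vuw.
  by rewrite (_ : det3 _ _ _ = det3 u v w) // /det3 !mxE; ring.
by rewrite uvw; split; vring.
Qed.

Theorem lie_classification : listed.
Proof.
have [[h [x [x0 hx]]]|none] := pselect (exists h x, x != 0 /\ b h x = x).
  exact: lie_eigen x0 hx.
apply: lie_noeigen => h x hx; apply/eqP/negP => /negP x0.
by apply: none; exists h, x.
Qed.
End Lie.

(** * Nilpotent products *)

Section Nilpotent.
Variable K : numClosedFieldType.
Variables m b : 'rV[K]_3 -> 'rV[K]_3 -> 'rV[K]_3.
Hypothesis P : is_poisson m b.
Implicit Types u v w x y z h : 'rV[K]_3.

Let listed := exists p : P3 K, poisson_iso m b (mulP p) (brP p).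

Lemma scaler_neq0_inj v (a : K) : v != 0 -> a *: v = 0 -> a = 0.
Proof. by move=> v0 /eqP; rewrite scaler_eq0 (negPf v0) orbF => /eqP. Qed.

Lemma pmulA x y z : m (m x y) z = m x (m y z). Proof. by rewrite (mul_assoc P). Qed.

Lemma pbrM x y z : b (m x y) z = m (b x z) y + m x (b y z). Proof. exact: (leibniz P). Qed.

(** The powers [x], [x^2], [x^3] form a basis: multiplying a relation by [x^2] and then by [x]
    isolates the coefficients. By Leibniz, powers of a single element have zero brackets. *)
Lemma nilpotent_chain x : m x (m x x) != 0 -> m x (m x (m x x)) = 0 -> listed.
Proof.
have [v xx] : exists v, m x x = v by eexists.
rewrite xx; have [w xv] : exists w, m x v = w by eexists.
rewrite xv => w0 xw.
have vx : m v x = w by rewrite (mul_comm P).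
have vv : m v v = 0 by rewrite -{1}xx pmulA xv.
have vw : m v w = 0 by rewrite -{1}xx pmulA xw (pmul0r P).
have wv : m w v = 0 by rewrite (mul_comm P).
have ww : m w w = 0 by rewrite -{1}xv pmulA vw (pmul0r P).
have bxv : b x v = 0 by rewrite (pbrC P) -xx pbrM (br_alt P) (pmul0l P) (pmul0r P) addr0 oppr0.
have bvx : b v x = 0 by rewrite (pbrC P) bxv oppr0.
have bxw : b x w = 0.
  by rewrite (pbrC P) -xv pbrM (br_alt P) bvx (pmul0l P) (pmul0r P) addr0 oppr0.
have bvw : b v w = 0 by rewrite -{1}xx pbrM bxw (pmul0l P) (pmul0r P) addr0.
exists P3_6; apply: (iso_of_basis P (e1 := x) (e2 := v) (e3 := w)).
- apply: det3_neq0 => a be c eq0.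
  have a0 : a = 0.
    apply: (scaler_neq0_inj w0); rewrite -(pmul0l P v) -eq0 !(bilinE P) xv vv wv.
    by vring.
  have be0 : be = 0.
    apply: (scaler_neq0_inj w0); rewrite -(pmul0r P x) -eq0 !(bilinE P) xx xv xw a0.
    by vring.
  split=> //; apply: (scaler_neq0_inj w0).
  by rewrite -eq0 a0 be0; vring.
- by table; rewrite xx xv xw; split; vring.
- by table; rewrite vv vw ww; split; vring.
- by table; rewrite bxv bxw bvw; split; vring.
Qed.

(** From [{u^2, v} = 2 u {u, v} = 0] and its mirror image, [{u, v}] has no [v]- or [u]-component. It
    is thus a multiple [r] of [u v], and [r] is the parameter of [P3_16]. *)
Lemma nilpotent_hyperbolic u v : m u u = 0 -> m v v = 0 -> det3 u v (m u v) != 0 -> listed.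
Proof.
move=> uu vv; have [z uv] : exists z, m u v = z by eexists.
rewrite uv => D0.
have vu : m v u = z by rewrite (mul_comm P).
have uz : m u z = 0 by rewrite -uv -pmulA uu (pmul0l P).
have vz : m v z = 0 by rewrite -vu -pmulA vv (pmul0l P).
have zz : m z z = 0 by rewrite -{1}uv pmulA vz (pmul0r P).
have z0 : z != 0 by apply: contraNneq D0 => ->; rewrite /det3 !mxE; apply/eqP; ring.
have [p [q [r buv]]] := det3_span (b u v) D0.
have n2 : (2 : K) != 0 by rewrite pnatr_eq0.
have q0 : q = 0.
  apply: (scaler_neq0_inj z0); apply: (scalerI n2).
  rewrite scaler0 -(pbr0l P v) -uu pbrM (mul_comm P _ u) buv !(bilinE P) uu uv uz.
  by vring.
have p0 : p = 0.
  apply: (scaler_neq0_inj z0); apply: (scalerI n2).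
  rewrite scaler0 -[RHS]oppr0 -(pbr0l P u) -vv pbrM (mul_comm P _ v) (pbrC P v u) buv.
  by rewrite !(bilinE P) vv vu vz; vring.
move: buv; rewrite p0 q0 !scale0r !add0r => buv.
have bvu : b v u = - (r *: z) by rewrite (pbrC P) buv.
have buz : b u z = 0.
  by rewrite (pbrC P) -uv pbrM (br_alt P) bvu !(bilinE P) uz; vring.
have bvz : b v z = 0.
  by rewrite (pbrC P) -uv pbrM (br_alt P) buv !(bilinE P) (mul_comm P z) vz; vring.
exists (P3_16 r); apply: (iso_of_basis P D0).
- by table; rewrite uu uv uz; split; vring.
- by table; rewrite vv vz zz; split; vring.
- by table; rewrite buv buz bvz; split; vring.
Qed.

(** Leibniz on [x y = 0] and [w = x^2] leaves only [{x, y} = q w + r y]. Nonzero [r] gives [P3_14];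
    for [r = 0], nonzero [q] gives [P3_15] and [q = 0] gives [P3_13]. *)
Lemma nilpotent_rank1 x w y : det3 x w y != 0 ->
  [/\ m x x = w, m x w = 0 & m w w = 0] ->
  [/\ m x y = 0, m w y = 0 & m y y = 0] -> listed.
Proof.
move=> D0 [xx xw ww] [xy wy yy].
have w0 : w != 0 by apply: contraNneq D0 => ->; rewrite /det3 !mxE; apply/eqP; ring.
have bxw : b x w = 0 by rewrite (pbrC P) -xx pbrM (br_alt P) (pmul0l P) (pmul0r P) addr0 oppr0.
have [p [q [r bxy]]] := det3_span (b x y) D0.
have p0 : p = 0.
  apply: (scaler_neq0_inj w0); rewrite -(oppr0) -(pbr0l P x) -xy pbrM (br_alt P).
  by rewrite (pbrC P y) bxy !(bilinE P) xx xw xy; vring.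
move: bxy; rewrite p0 scale0r add0r => bxy.
have bwy : b w y = 0.
  by rewrite -{1}xx pbrM (mul_comm P _ x) bxy !(bilinE P) xw xy; vring.
have [r0|r0] := eqVneq r 0; last first.
  exists P3_14.
  apply: (iso_of_basis P (e1 := r^-1 *: x) (e2 := r^-2 *: w) (e3 := y + (q / r) *: w)).
  - rewrite (_ : det3 _ _ _ = r ^- 3 * det3 x w y); last by rewrite /det3 !mxE; field.
    by rewrite mulf_neq0 // invr_neq0 // expf_neq0.
  - by table; rewrite !(bilinE P) xx xw xy; split; vfield.
  - by table; rewrite !(bilinE P) (mul_comm P y) ww wy yy; split; vfield.
  - by table; rewrite !(bilinE P) (br_alt P) bxw bwy bxy; split; vfield.
have [q0|q0] := eqVneq q 0.
  exists P3_13; apply: (iso_of_basis P D0).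
  - by table; rewrite xx xw xy; split; vring.
  - by table; rewrite ww wy yy; split; vring.
  - by table; rewrite bxw bxy bwy r0 q0; split; vring.
exists P3_15; apply: (iso_of_basis P (e1 := x) (e2 := w) (e3 := q^-1 *: y)).
- rewrite (_ : det3 _ _ _ = q^-1 * det3 x w y); last by rewrite /det3 !mxE; ring.
  by rewrite mulf_neq0 ?invr_neq0.
- by table; rewrite !(bilinE P) xx xw xy; split; vfield.
- by table; rewrite !(bilinE P) ww wy yy; split; vfield.
- by table; rewrite !(bilinE P) bxw bwy bxy r0; split; vfield.
Qed.

(** Polarisation of the cubic identity: [(x + y)^3 - (x - y)^3 - 2 y^3 = 6 x^2 y]. *)
Lemma cube_zero_sq_ann : (forall x, m x (m x x) = 0) -> forall x y, m (m x x) y = 0.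
Proof.
move=> cube x y; have n6 : (6 : K) != 0 by rewrite pnatr_eq0.
apply: (scalerI n6); rewrite scaler0.
have -> : 6 *: m (m x x) y =
    m (x + y) (m (x + y) (x + y)) - m (x - y) (m (x - y) (x - y)) - 2 *: m y (m y y).
  have yxx : m y (m x x) = m x (m x y) by rewrite (mul_comm P) pmulA.
  have yxy : m y (m x y) = m x (m y y) by rewrite (mul_comm P) pmulA.
  by rewrite !(bilinE P) (mul_comm P y x) pmulA yxx yxy; vring.
by rewrite !cube scaler0 !subr0.
Qed.

(** Since [w = x^2] annihilates everything, a suitable [y] makes the product a symmetric form
    diag(1, [e]) with values in the line of [w]: rank one for [e = 0], hyperbolic otherwise. *)
Lemma nilpotent_cube_zero x : (forall y, m y (m y y) = 0) -> m x x != 0 -> listed.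
Proof.
move=> cube; have [w xx] : exists w, m x x = w by eexists.
rewrite xx => w0.
have ann := cube_zero_sq_ann cube.
have wz z : m w z = 0 by rewrite -xx ann.
have zw z : m z w = 0 by rewrite (mul_comm P) wz.
have [|y0 D0] := @det3_complete _ x w.
  move=> a c eq0; have a0 : a = 0.
    by apply: (scaler_neq0_inj w0); rewrite -(pmul0r P x) -eq0 !(bilinE P) xx zw; vring.
  by split=> //; apply: (scaler_neq0_inj w0); rewrite -eq0 a0; vring.
have [a [c [d xy0]]] := det3_span (m x y0) D0.
(* These are coordinates of [x (x y0) = x^2 y0 = 0]. *)
have [_ _ /eqP] : [/\ 0 = 0 :> K, a + d * c = 0 & d ^+ 2 = 0].
  have [] := @det3_free _ x w y0 (d * a) (a + d * c) (d ^+ 2) D0 => //.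
  by rewrite -[RHS](wz y0) -xx pmulA xy0 !(bilinE P) xx zw xy0; vring.
rewrite sqrf_eq0 => /eqP d0.
have a0 : a = 0.
  apply: (scaler_neq0_inj w0).
  by rewrite -[RHS](wz y0) -xx pmulA xy0 !(bilinE P) xx zw xy0 d0; vring.
have [y [D1 xy]] : exists y, det3 x w y != 0 /\ m x y = 0.
  exists (y0 - c *: x); split.
    by rewrite (_ : det3 _ _ _ = det3 x w y0) // /det3 !mxE; ring.
  by rewrite !(bilinE P) xx xy0 a0 d0; vring.
have yx : m y x = 0 by rewrite (mul_comm P).
have [p [e [f yy]]] := det3_span (m y y) D1.
have p0 : p = 0.
  by apply: (scaler_neq0_inj w0); rewrite -(pmul0l P y) -xy pmulA yy !(bilinE P) xx zw xy; vring.
have yyw : m y y = e *: w.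
  have f0 : f *: m y y = 0.
    by rewrite -(cube y) yy !(bilinE P) yx zw yy p0; vring.
  move/eqP: f0; rewrite scaler_eq0 => /orP[/eqP f0|/eqP y0'].
    by rewrite yy p0 f0; vring.
  have [|_ -> _] := @det3_free _ x w y p e f D1; first by rewrite -yy.
  by rewrite y0' scale0r.
have [e0|e0] := eqVneq e 0.
  by apply: (nilpotent_rank1 D1); split=> //; rewrite yyw e0 scale0r.
(* The isotropic vectors of diag(1, [e]) are [x + y / s] and [x - y / s] with [s^2 = - e]. *)
pose s := sqrtC (- e).
have sE : s ^+ 2 = - e by rewrite sqrtCK.
have s0 : s != 0 by rewrite -sqrf_eq0 sE oppr_eq0.
have es : e = - s ^+ 2 by rewrite sE opprK.
have uv : m (x + s^-1 *: y) (x - s^-1 *: y) = 2 *: w.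
  by rewrite !(bilinE P) xx xy yx yyw es; vfield.
apply: (@nilpotent_hyperbolic (x + s^-1 *: y) (x - s^-1 *: y)).
- by rewrite !(bilinE P) xx xy yx yyw es; vfield.
- by rewrite !(bilinE P) xx xy yx yyw es; vfield.
- rewrite uv (_ : det3 _ _ _ = 4 / s * det3 x w y).
    by rewrite !mulf_neq0 ?invr_neq0 // pnatr_eq0.
  by rewrite /det3 !mxE; field.
Qed.

Theorem nilpotent_classification : (forall x, m x (m x (m x x)) = 0) -> listed.
Proof.
move=> nil; have [cube|] := pselect (forall x, m x (m x x) = 0); last first.
  by move=> /existsNP[x /eqP x3]; apply: (nilpotent_chain x3).
have [sq|] := pselect (forall x, m x x = 0); last first.
  by move=> /existsNP[x /eqP x2]; apply: (nilpotent_cube_zero cube x2).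
apply: (lie_classification P) => x y; have n2 : (2 : K) != 0 by rewrite pnatr_eq0.
apply: (scalerI n2); rewrite scaler0 -(sq (x + y)) !(bilinE P) !sq (mul_comm P y).
by vring.
Qed.
End Nilpotent.

(** * Products with an idempotent *)

Section Idempotent.
Variable K : numClosedFieldType.
Variables m b : 'rV[K]_3 -> 'rV[K]_3 -> 'rV[K]_3.
Hypothesis P : is_poisson m b.
Implicit Types e f t u v w x y z h : 'rV[K]_3.

Let listed := exists p : P3 K, poisson_iso m b (mulP p) (brP p).
Let pmulA := pmulA P.
Let pbrM := pbrM P.
Let mC := mul_comm P.
Let n2 : (2 : K) != 0. Proof. by rewrite pnatr_eq0. Qed.

(** For [z = {e, x} = {e^2, x}] Leibniz gives [z = 2 e z]; multiplying by [e] gives [e z = 2 e z],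
    so [e z], and with it [z], vanishes. *)
Lemma idempotent_br e x : m e e = e -> b e x = 0.
Proof.
move=> ee; have [z ex] : exists z, b e x = z by eexists.
have e1 : z = 2 *: m e z.
  by rewrite -{1}ex -{1}ee pbrM ex (mC z); vring.
have e2 : m e z = 0.
  have : m e z = 2 *: m e z by rewrite {1}e1 (pmulZr P) -pmulA ee.
  by move=> e2; apply: (addIr (m e z)); rewrite add0r [in RHS]e2; vring.
by rewrite ex e1 e2 scaler0.
Qed.

(** The algebra is the product of a quadratic unital algebra on [e], [x] and the line of [y], with
    zero bracket. The first factor is the dual numbers or two copies of the field, the second has
    zero square or an idempotent: [P3_11], [P3_8], [P3_10], [P3_7]. *)
Lemma idempotent_rank2 e x y : det3 e x y != 0 -> m e e = e -> m e x = x -> m e y = 0 -> listed.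
Proof.
move=> D0 ee ex ey.
have xe : m x e = x by rewrite mC.
have ye : m y e = 0 by rewrite mC.
have xy : m x y = 0 by rewrite -xe pmulA ey (pmul0r P).
have bex : b e x = 0 by exact: idempotent_br.
have bey : b e y = 0 by exact: idempotent_br.
have bxy : b x y = 0.
  (* [e] fixes [{x, y}] because it fixes [x], and kills it because it kills [y]. *)
  have -> : b x y = m e (b x y) by rewrite -{1}ex pbrM bey (pmul0l P) add0r.
  rewrite (pbrC P) (pmulNr P); have := pbr0l P x.
  by rewrite -{1}ey pbrM bex (pmul0l P) add0r => ->; rewrite oppr0.
have [a [be [c xx]]] := det3_span (m x x) D0.
have exx : m e (m x x) = m x x by rewrite -pmulA ex.
have c0 : c = 0.
  have [|_ _ /eqP] := @det3_free _ e x y 0 0 (- c) D0; last by rewrite oppr_eq0 => /eqP.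
  by rewrite -(subrr (m x x)) -{1}exx xx !(bilinE P) ee ex ey; vring.
have [p [q [r yy]]] := det3_span (m y y) D0.
have [p0 q0 _] : [/\ p = 0, q = 0 & 0 = 0 :> K].
  apply: (det3_free D0); rewrite -(pmul0l P y) -ey pmulA yy !(bilinE P) ee ex ey; vring.
move: xx yy; rewrite c0 p0 q0 !scale0r !addr0 !add0r => xx yy.
(* Completing the square in [x^2 = a e + be x]; for nonzero [a1 = s^2] the idempotents are
   [(e + x1 / s) / 2] and [(e - x1 / s) / 2]. *)
pose x1 := x - (be / 2) *: e; pose a1 := a + be ^+ 2 / 4.
have D1 : det3 e x1 y != 0 by rewrite (_ : det3 e x1 y = det3 e x y) // /det3 !mxE; ring.
have x1x1 : m x1 x1 = a1 *: e.
  by rewrite /x1 /a1 !(bilinE P) xx ex xe ee; vfield.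
have ex1 : m e x1 = x1 by rewrite /x1 !(bilinE P) ex ee.
have x1y : m x1 y = 0 by rewrite /x1 !(bilinE P) xy ey; vring.
have bex1 : b e x1 = 0 by exact: idempotent_br.
have bx1y : b x1 y = 0 by rewrite /x1 !(bilinE P) bxy bey; vring.
clearbody x1 a1.
have x1e : m x1 e = x1 by rewrite mC.
have yx1 : m y x1 = 0 by rewrite mC.
have byx1 : b y x1 = 0 by rewrite (pbrC P) bx1y oppr0.
have bye : b y e = 0 by rewrite (pbrC P) bey oppr0.
have bx1e : b x1 e = 0 by rewrite (pbrC P) bex1 oppr0.
have [y1 [D2 ey1 [x1y1 bey1 bx1y1] yy1]] : exists y1, [/\ det3 e x1 y1 != 0, m e y1 = 0,
    [/\ m x1 y1 = 0, b e y1 = 0 & b x1 y1 = 0] & m y1 y1 = 0 \/ m y1 y1 = y1].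
  have [r0|r0] := eqVneq r 0.
    by exists y; split=> //; left; rewrite yy r0 scale0r.
  exists (r^-1 *: y); split.
  - rewrite (_ : det3 _ _ _ = r^-1 * det3 e x1 y); last by rewrite /det3 !mxE; ring.
    by rewrite mulf_neq0 ?invr_neq0.
  - by rewrite (pmulZr P) ey scaler0.
  - by rewrite !(bilinE P) x1y bey bx1y !scaler0.
  - by right; rewrite !(bilinE P) yy; vfield.
have y1e : m y1 e = 0 by rewrite mC.
have y1x1 : m y1 x1 = 0 by rewrite mC.
have by1e : b y1 e = 0 by rewrite (pbrC P) bey1 oppr0.
have by1x1 : b y1 x1 = 0 by rewrite (pbrC P) bx1y1 oppr0.
have table3 := (ee, ex1, x1e, ey1, y1e, x1x1, x1y1, y1x1).
have btable3 := (bex1, bx1e, bey1, by1e, bx1y1, by1x1, br_alt P).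
have [a0|a0] := eqVneq a1 0.
  case: yy1 => yy1.
    exists P3_11; apply: (iso_of_basis P D2); table; rewrite ?table3 ?btable3 ?yy1 ?a0.
    - by split; vring. - by split; vring. - by split; vring.
  exists P3_8; apply: (iso_of_basis P (e1 := y1) (e2 := e) (e3 := x1)).
  - by rewrite (_ : det3 _ _ _ = det3 e x1 y1) // /det3; ring.
  - by table; rewrite ?table3 yy1; split; vring.
  - by table; rewrite ?table3 a0; split; vring.
  - by table; rewrite ?btable3; split; vring.
pose s := sqrtC a1; have sE : s ^+ 2 = a1 by rewrite sqrtCK.
have s0 : s != 0 by rewrite -sqrf_eq0 sE.
clearbody s; subst a1.
have D3 : det3 (2^-1 *: (e + s^-1 *: x1)) (2^-1 *: (e - s^-1 *: x1)) y1 != 0.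
  rewrite (_ : det3 _ _ _ = - (2 * s)^-1 * det3 e x1 y1); last first.
    by rewrite /det3 !mxE; field.
  by rewrite mulf_neq0 // oppr_eq0 invr_neq0 // mulf_neq0.
case: yy1 => yy1; [exists P3_10|exists P3_7]; apply: (iso_of_basis P D3); table;
  rewrite !(bilinE P) ?table3 ?btable3 ?yy1; by split; vfield.
Qed.

(** Each basis vector splits as [z = e z + (z - e z)], and by additivity of the determinant one of
    the two Peirce components can replace it. *)
Lemma split_basis e : e != 0 -> m e e = e -> exists x y,
  [/\ det3 e x y != 0, m e x = 0 \/ m e x = x & m e y = 0 \/ m e y = y].
Proof.
move=> e0 ee.
have [x0 [y0 D0]] : exists x y, det3 e x y != 0.
  apply: contrapT => none.
  have D0 x y : det3 e x y = 0.
    by apply/eqP/negP => /negP nz; apply: none; exists x, y.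
  case/eqP: e0; apply: row3P; rewrite mxE.
  - by rewrite -(D0 (v3 0 1 0) (v3 0 0 1)) /det3 !mxE /=; ring.
  - by rewrite -(D0 (v3 0 0 1) (v3 1 0 0)) /det3 !mxE /=; ring.
  - by rewrite -(D0 (v3 1 0 0) (v3 0 1 0)) /det3 !mxE /=; ring.
have split z : (m e (m e z) = m e z) * (m e (z - m e z) = 0).
  have eez : m e (m e z) = m e z by rewrite -pmulA ee.
  by split=> //; rewrite !(bilinE P) eez subrr.
have [x Dx ex] : exists2 x, det3 e x y0 != 0 & m e x = 0 \/ m e x = x.
  have [D1|D1] := eqVneq (det3 e (m e x0) y0) 0; last first.
    by exists (m e x0) => //; right; rewrite split.
  exists (x0 - m e x0); last by left; rewrite split.
  apply: contra D0 => /eqP D2; apply/eqP; rewrite -[RHS](addr0 0) -{1}D1 -D2.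
  by rewrite /det3 !mxE; ring.
exists x; have [D1|D1] := eqVneq (det3 e x (m e y0)) 0; last first.
  by exists (m e y0); split=> //; right; rewrite split.
exists (y0 - m e y0); split=> //; last by left; rewrite split.
apply: contra Dx => /eqP D2; apply/eqP; rewrite -[RHS](addr0 0) -{1}D1 -D2.
by rewrite /det3 !mxE; ring.
Qed.

Definition plane x y u := exists a c : K, u = a *: x + c *: y.

Lemma plane_lin x y a u v : plane x y u -> plane x y v -> plane x y (a *: u + v).
Proof.
move=> [a1 [c1 ->]] [a2 [c2 ->]]; exists (a * a1 + a2), (a * c1 + c2); vring.
Qed.

Lemma plane_l x y : plane x y x.
Proof. by exists 1, 0; rewrite scale1r scale0r addr0. Qed.

Lemma plane_r x y : plane x y y.
Proof. by exists 0, 1; rewrite scale1r scale0r add0r. Qed.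

Lemma plane_transverse e x y a : det3 e x y != 0 -> plane x y (a *: e) -> a = 0.
Proof.
move=> D0 [p [q epq]]; have [] := @det3_free _ e x y a (- p) (- q) D0 => //.
by rewrite epq; vring.
Qed.

(** A nilpotent product on a plane is zero or has a basis [t], [t^2]. The index 4 supplied by
    Fitting drops to 3 because [t], [t^2], [t^3] cannot be independent in a plane. *)
Lemma nil_plane e x y : det3 e x y != 0 ->
  (forall u v, plane x y u -> plane x y v -> plane x y (m u v)) ->
  (forall t, plane x y t -> m t (m t (m t t)) = 0) ->
  [/\ m x x = 0, m x y = 0 & m y y = 0] \/
  exists t, [/\ plane x y t, det3 e t (m t t) != 0 & m t (m t t) = 0].
Proof.
move=> D0 clos nil.
have [sq|] := pselect (forall t, plane x y t -> m t t = 0); [left|move=> nsq; right].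
  have xx := sq _ (plane_l x y); have yy := sq _ (plane_r x y).
  split=> //; apply: (scalerI n2); rewrite scaler0.
  have : plane x y (x + y) by exists 1, 1; rewrite !scale1r.
  by move=> /sq <-; rewrite !(bilinE P) xx yy (mC y); vring.
move: nsq => /existsNP[t /not_implyP[Nt /eqP]].
have [v tt] : exists v, m t t = v by eexists.
rewrite tt => v0; have [w tv] : exists w, m t v = w by eexists.
have tw : m t w = 0 by rewrite -tv -tt nil.
have Nv : plane x y v by rewrite -tt; apply: clos.
have Nw : plane x y w by rewrite -tv; apply: clos.
have D1 : det3 e t v != 0.
  apply: det3_neq0 => a c d eq0; have a0 : a = 0.
    apply: (plane_transverse D0).
    have -> : a *: e = (- c) *: t + ((- d - 1) *: v + v).
      by rewrite -[LHS]subr0 -eq0; vring.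
    by do 2?apply: plane_lin.
  move: eq0; rewrite a0 scale0r add0r => eq0.
  have w0 : c *: w = 0.
    have : m t (m t (c *: t + d *: v)) = 0 by rewrite eq0 !(pmul0r P).
    by rewrite !(bilinE P) tt !tv tw scaler0 addr0.
  have cv : c *: v = 0.
    have [->|c0] := eqVneq c 0; first by rewrite scale0r.
    have -> : c *: v = m t (c *: t + d *: v) - (d / c) *: (c *: w).
      by rewrite !(bilinE P) tt tv; vfield.
    by rewrite eq0 w0 (pmul0r P) scaler0 subr0.
  have c0 := scaler_neq0_inj v0 cv.
  by split=> //; apply: (scaler_neq0_inj v0); rewrite -eq0 c0; vring.
exists t; rewrite tt tv; split=> //.
have [a [c [d wE]]] := det3_span w D1.
have a0 : a = 0.
  apply: (plane_transverse D0).
  have -> : a *: e = (- c) *: t + ((- d) *: v + w) by rewrite wE; vring.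
  by do 2?apply: plane_lin.
move: wE; rewrite a0 scale0r add0r => wE.
have cw : c *: w = 0.
  have : m t (m t (c *: t + d *: v)) = 0 by rewrite -wE tw (pmul0r P).
  by rewrite !(bilinE P) tt !tv tw scaler0 addr0.
have [//|w0] := eqVneq w 0; case/eqP: (w0).
have c0 := scaler_neq0_inj w0 cw.
have dw : d *: w = 0.
  have : m t (c *: t + d *: v) = 0 by rewrite -wE.
  by rewrite c0 scale0r add0r (pmulZr P) tv.
by rewrite wE c0 (scaler_neq0_inj w0 dw) !scale0r addr0.
Qed.

(** The two Lie algebras of dimension two, abelian and affine; the new basis stays in the plane,
    where the associative product is already known. *)
Lemma plane_br_cases e x y p q : det3 e x y != 0 -> b x y = p *: x + q *: y ->
  b x y = 0 \/ exists x1 y1, [/\ det3 e x1 y1 != 0, plane x y x1, plane x y y1 & b x1 y1 = x1].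
Proof.
move=> D0 bxy; have byx : b y x = - (p *: x + q *: y) by rewrite (pbrC P) bxy.
have [p0|p0] := eqVneq p 0; last first.
  right; exists (p *: x + q *: y), (p^-1 *: y); split.
  - by rewrite (_ : det3 _ _ _ = det3 e x y) // /det3 !mxE; field.
  - by exists p, q.
  - by exists 0, p^-1; rewrite scale0r add0r.
  - by rewrite !(bilinE P) (br_alt P) bxy; vfield.
have [q0|q0] := eqVneq q 0; first by left; rewrite bxy p0 q0; vring.
right; exists y, (- q^-1 *: x); split.
- rewrite (_ : det3 _ _ _ = q^-1 * det3 e x y); last by rewrite /det3 !mxE; ring.
  by rewrite mulf_neq0 ?invr_neq0.
- exact: plane_r.
- by exists (- q^-1), 0; rewrite scale0r addr0.
- by rewrite !(bilinE P) byx p0; vfield.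
Qed.

(** If the annihilator of [e] contains an idempotent [f], then [f] or [e + f] falls under
    [idempotent_rank2]. Otherwise Fitting makes this annihilator a nilpotent plane. *)
Lemma idempotent_rank1 e x y : det3 e x y != 0 -> m e e = e -> m e x = 0 -> m e y = 0 -> listed.
Proof.
move=> D0 ee ex ey.
have e0 : e != 0 by apply: contraNneq D0 => ->; rewrite /det3 !mxE; apply/eqP; ring.
have xe : m x e = 0 by rewrite mC.
have ye : m y e = 0 by rewrite mC.
have bex : b e x = 0 := idempotent_br x ee.
have bey : b e y = 0 := idempotent_br y ee.
have planeP u : m e u = 0 -> plane x y u.
  have [a [c [d ->]]] := det3_span u D0; rewrite !(bilinE P) ee ex ey !scaler0 !addr0.
  by move=> ae; exists c, d; rewrite (scaler_neq0_inj e0 ae) scale0r add0r.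
have plane0 u : plane x y u -> m e u = 0.
  by move=> [a [c ->]]; rewrite !(bilinE P) ex ey; vring.
have [[f [f0 ff ef]]|none] := pselect (exists f, [/\ f != 0, m f f = f & m e f = 0]).
  have fe : m f e = 0 by rewrite mC.
  have [|z0 Dz0] := @det3_complete _ e f.
    move=> a c eq0; have a0 : a = 0.
      by apply: (scaler_neq0_inj e0); rewrite -(pmul0r P e) -eq0 !(bilinE P) ee ef; vring.
    by split=> //; apply: (scaler_neq0_inj f0); rewrite -eq0 a0; vring.
  have [a eza] : exists a, m e z0 = a *: e.
    have [a [c [d ->]]] := det3_span z0 D0; exists a.
    by rewrite !(bilinE P) ee ex ey; vring.
  have [z [Dz ez]] : exists z, det3 e f z != 0 /\ m e z = 0.
    exists (z0 - a *: e); split; last by rewrite !(bilinE P) eza ee subrr.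
    by rewrite (_ : det3 _ _ _ = det3 e f z0) // /det3 !mxE; ring.
  have ffz : m f (m f z) = m f z by rewrite -pmulA ff.
  have efz : m e (m f z) = 0 by rewrite -pmulA ef (pmul0l P).
  have [D1|D1] := eqVneq (det3 e f (m f z)) 0; last first.
    apply: (@idempotent_rank2 f (m f z) e) => //.
    by rewrite (_ : det3 _ _ _ = det3 e f (m f z)) // /det3; ring.
  apply: (@idempotent_rank2 (e + f) e (z - m f z)).
  - rewrite (_ : det3 _ _ _ = - (det3 e f z - det3 e f (m f z))).
      by rewrite D1 subr0 oppr_eq0.
    by rewrite /det3 !mxE; ring.
  - by rewrite !(bilinE P) ee ff ef fe; vring.
  - by rewrite !(bilinE P) ee fe addr0.
  - by rewrite !(bilinE P) ez efz ffz; vring.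
have [||[xx xy yy]|[t [Nt Dt t3]]] := @nil_plane e x y D0.
- by move=> u v /plane0 eu _; apply: planeP; rewrite -pmulA eu (pmul0l P).
- move=> t /plane0 et; have [//|[f [f0 ff ft]]] := nilpotent_or_idempotent P t.
  case: none; exists f; split=> //; apply: (ft (fun u => m e u = 0)) => //.
    by move=> a u v eu ev; rewrite !(bilinE P) eu ev scaler0 addr0.
  by move=> u eu; rewrite mC pmulA (mC u) eu (pmul0r P).
- have [p [q [r bxy]]] := det3_span (b x y) D0.
  (* The bracket preserves the plane: [0 = {e x, y} = e {x, y}]. *)
  have p0 : p = 0.
    apply: (scaler_neq0_inj e0); rewrite -(pbr0l P y) -ex pbrM bey (pmul0l P) add0r bxy.
    by rewrite !(bilinE P) ee ex ey; vring.
  move: bxy; rewrite p0 scale0r add0r => bxy.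
  case: (plane_br_cases D0 bxy) => [bxy0|[x1 [y1 [D1 Nx1 Ny1 bxy1]]]].
    exists P3_19; apply: (iso_of_basis P D0); table.
    - by rewrite ee ex ey; split; vring.
    - by rewrite xx xy yy; split; vring.
    - by rewrite bex bey bxy0; split; vring.
  have yx : m y x = 0 by rewrite mC.
  have sq u v : plane x y u -> plane x y v -> m u v = 0.
    move=> [a [c ->]] [a' [c' ->]].
    by rewrite !(bilinE P) xx xy yx yy; vring.
  exists P3_20; apply: (iso_of_basis P D1); table.
  - by rewrite ee (plane0 _ Nx1) (plane0 _ Ny1); split; vring.
  - by rewrite !sq //; split; vring.
  - by rewrite !(idempotent_br _ ee) bxy1; split; vring.
- have [v tt] : exists v, m t t = v by eexists.
  move: Dt t3; rewrite tt => Dt tv.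
  have et := plane0 _ Nt; have ev : m e v = 0 by rewrite -tt -pmulA et (pmul0l P).
  have vv : m v v = 0 by rewrite -{1}tt pmulA tv (pmul0r P).
  have btv : b t v = 0 by rewrite (pbrC P) -tt pbrM (br_alt P) (pmul0l P) (pmul0r P) addr0 oppr0.
  exists P3_12; apply: (iso_of_basis P Dt); table.
  - by rewrite ee et ev; split; vring.
  - by rewrite tt tv vv; split; vring.
  - by rewrite !(idempotent_br _ ee) btv; split; vring.
Qed.

Lemma unital_nonlocal e f : (forall x, m e x = x) ->
  f != 0 -> f != e -> m f f = f -> listed.
Proof.
move=> unit f0 fe ff; have [x [y [D0 fx fy]]] := split_basis f0 ff.
case: fx => fx; case: fy => fy.
- exact: idempotent_rank1 D0 _ _ _.
- apply: (@idempotent_rank2 f y x) => //.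
  rewrite (_ : det3 _ _ _ = - det3 f x y) ?oppr_eq0 //.
  by rewrite /det3; ring.
- exact: idempotent_rank2 D0 _ _ _.
- case/eqP: fe; rewrite -(unit f) mC.
  have [a [c [d ->]]] := det3_span e D0.
  by rewrite !(bilinE P) ff fx fy.
Qed.

(* [x0] and [y0] are first shifted by eigenvalues to become non-invertible, hence
   nilpotent; an eigenvector of one of them then shows that their span is an ideal. *)
Lemma idempotent_unital e x0 y0 : det3 e x0 y0 != 0 -> (forall x, m e x = x) -> listed.
Proof.
move=> D0 unit; have ee := unit e.
have e0 : e != 0 by apply: contraNneq D0 => ->; rewrite /det3 !mxE; apply/eqP; ring.
have [[f [f0 fe ff]]|none] := pselect (exists f, [/\ f != 0, f != e & m f f = f]).
  exact: unital_nonlocal unit f0 fe ff.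
have local f : f != 0 -> m f f = f -> f = e.
  move=> f0 ff; apply/eqP/negP => /negP fe; apply: none; by exists f.
(* A zero divisor is nilpotent: an idempotent in the span of its powers would also kill [v], yet the
   only nonzero idempotent is the unit. *)
have nilp x v : v != 0 -> m x v = 0 -> m x (m x (m x x)) = 0.
  move=> v0 xv; have [//|[f [f0 ff fx]]] := nilpotent_or_idempotent P x.
  case/eqP: v0; rewrite -(unit v) -(local f f0 ff).
  apply: (fx (fun u => m u v = 0)) => //.
    by move=> a u w uv wv; rewrite !(bilinE P) uv wv scaler0 addr0.
  by move=> u uv; rewrite pmulA uv (pmul0r P).
have shift x : exists l v, v != 0 /\ m (x - l *: e) v = 0.
  have [l /eigenvalueP[v]] := eigenvalue_closed (mulmat m x) (isT : (0 < 3)%N).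
  rewrite (mulmatE P) => xv v0; exists l, v; split=> //.
  by rewrite !(bilinE P) xv unit subrr.
have [l [v [v0 xv]]] := shift x0; have [l' [v' [v'0 yv]]] := shift y0.
have [x Ex] : exists x, x0 - l *: e = x by eexists.
have [y Ey] : exists y, y0 - l' *: e = y by eexists.
rewrite Ex in xv; rewrite Ey in yv.
have {}D0 : det3 e x y != 0.
  by rewrite (_ : det3 _ _ _ = det3 e x0 y0) // -Ex -Ey /det3 !mxE; ring.
have nx := nilp _ _ v0 xv; have ny := nilp _ _ v'0 yv.
(* Multiplying by [t] gives [a t + d w t = 0]. For nonzero [d] this makes [t] an eigenvector of the
   nilpotent [w] for [- a / d], so [a = 0]. *)
have noe u w z a c d t : t != 0 -> m u t = 0 -> m w (m w (m w w)) = 0 ->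
    m u z = a *: e + c *: u + d *: w -> a = 0.
  move=> t0 ut nw uz; have : m (m u z) t = 0 by rewrite (mC u) pmulA ut (pmul0r P).
  rewrite uz !(bilinE P) unit ut scaler0 addr0 => eq0.
  have [d0|d0] := eqVneq d 0.
    by apply: (scaler_neq0_inj t0); move: eq0; rewrite d0 scale0r addr0.
  have wt : m w t = - (a / d) *: t.
    have -> : m w t = d^-1 *: (a *: t + d *: m w t) - (a / d) *: t by vfield.
    by rewrite eq0 scaler0 add0r scaleNr.
  have : (a / d) ^+ 4 *: t = 0.
    rewrite -(pmul0l P t) -nw !pmulA wt !(bilinE P) wt !(bilinE P) wt !(bilinE P) wt.
    by vring.
  move/(scaler_neq0_inj t0)/eqP; rewrite expf_eq0 /= mulf_eq0 invr_eq0 (negPf d0) orbF.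
  by move/eqP.
have Nxx : plane x y (m x x).
  have [a [c [d xx]]] := det3_span (m x x) D0; exists c, d.
  by rewrite xx (noe x y x a c d v) // scale0r add0r.
have Nxy : plane x y (m x y).
  have [a [c [d xy]]] := det3_span (m x y) D0; exists c, d.
  by rewrite xy (noe x y y a c d v) // scale0r add0r.
have Nyy : plane x y (m y y).
  have [a [c [d yy]]] := det3_span (m y y) D0; exists c, d.
  rewrite yy (noe y x y a d c v') // ?scale0r ?add0r //.
  by rewrite yy; vring.
have clos u w : plane x y u -> plane x y w -> plane x y (m u w).
  have plane0 : plane x y 0 by exists 0, 0; rewrite !scale0r addr0.
  move=> [a [c ->]] [a' [c' ->]].
  have -> : m (a *: x + c *: y) (a' *: x + c' *: y) =
     (a * a') *: m x x + ((a * c' + c * a') *: m x y + ((c * c') *: m y y + 0)).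
    by rewrite !(bilinE P) (mC y x); vring.
  by do 3?apply: plane_lin.
have [|[xx xy yy]|[t [Nt Dt t3]]] := @nil_plane e x y D0 clos.
- move=> t Nt; have [//|[f [f0 ff ft]]] := nilpotent_or_idempotent P t.
  have Nf : plane x y f.
    by apply: ft => // [a u w|u]; [apply: plane_lin|apply: clos].
  have := local f f0 ff => fe; move: Nf; rewrite fe -[e]scale1r.
  by move=> /(plane_transverse D0)/eqP; rewrite oner_eq0.
- have x00 : x != 0 by apply: contraNneq D0 => ->; rewrite /det3 !mxE; apply/eqP; ring.
  have xe : m x e = x by rewrite mC.
  have [p [q [r bxy]]] := det3_span (b x y) D0.
  (* As [e] is the unit and [x x = x y = 0], Leibniz gives [0 = {x^2, y} = 2 x {x, y} = 2 p x]. *)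
  have p0 : p = 0.
    apply: (scaler_neq0_inj x00); apply: (scalerI n2); rewrite scaler0.
    rewrite -(pbr0l P y) -xx pbrM (mC _ x) bxy !(bilinE P) xe xx xy.
    by vring.
  move: bxy; rewrite p0 scale0r add0r => bxy.
  case: (plane_br_cases D0 bxy) => [bxy0|[x1 [y1 [D1 Nx1 Ny1 bxy1]]]].
    exists P3_17; apply: (iso_of_basis P D0); table.
    - by rewrite !unit; split; vring.
    - by rewrite xx xy yy; split; vring.
    - by rewrite !(idempotent_br _ ee) bxy0; split; vring.
  have yx : m y x = 0 by rewrite mC.
  have sq u w : plane x y u -> plane x y w -> m u w = 0.
    move=> [a [c ->]] [a' [c' ->]].
    by rewrite !(bilinE P) xx xy yx yy; vring.
  exists P3_18; apply: (iso_of_basis P D1); table.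
  - by rewrite !unit; split; vring.
  - by rewrite !sq //; split; vring.
  - by rewrite !(idempotent_br _ ee) bxy1; split; vring.
- have [w tt] : exists w, m t t = w by eexists.
  move: Dt t3; rewrite tt => Dt tw.
  have ww : m w w = 0 by rewrite -{1}tt pmulA tw (pmul0r P).
  have btw : b t w = 0 by rewrite (pbrC P) -tt pbrM (br_alt P) (pmul0l P) (pmul0r P) addr0 oppr0.
  exists P3_9; apply: (iso_of_basis P Dt); table.
  - by rewrite !unit; split; vring.
  - by rewrite tt tw ww; split; vring.
  - by rewrite !(idempotent_br _ ee) btw; split; vring.
Qed.

Theorem coordinate_classification : listed.
Proof.
have [nil|] := pselect (forall x, m x (m x (m x x)) = 0).
  exact: nilpotent_classification.
move=> /existsNP[x x4]; have [//|[e [e0 ee _]]] := nilpotent_or_idempotent P x.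
have [u [v [D0 eu ev]]] := split_basis e0 ee.
case: eu => eu; case: ev => ev.
- exact: idempotent_rank1 D0 _ _ _.
- apply: (@idempotent_rank2 e v u) => //.
  rewrite (_ : det3 _ _ _ = - det3 e u v) ?oppr_eq0 //.
  by rewrite /det3; ring.
- exact: idempotent_rank2 D0 _ _ _.
- apply: (idempotent_unital D0) => z; have [a [c [d ->]]] := det3_span z D0.
  by rewrite !(bilinE P) ee eu ev.
Qed.
End Idempotent.

Theorem classification (K : numClosedFieldType) (V : vectType K) mul br :
  \dim (fullv : {vspace V}) = 3%N -> @is_poisson K V mul br ->
  exists p : P3 K, poisson_iso mul br (mulP p) (brP p).
Proof.
move=> dimV P; have [m [b [Pmb iso]]] := poisson_coordinates dimV P.
have [p isop] := coordinate_classification Pmb.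
by exists p; apply: poisson_iso_trans iso isop.
Qed.

(** * Isomorphism invariants *)

Section Invariants.
Variable K : fieldType.

Section Properties.
Variables (V : lmodType K) (m b : V -> V -> V).
Definition trivial_op := forall x y, m x y = 0.
Definition two_step_nilpotent := forall x y z, m x (m y z) = 0.
Definition metabelian := forall x y z t, m (m x y) (m z t) = 0.
Definition nil3 := forall x, m x (m x x) = 0.
Definition nil4 := forall x, m x (m x (m x x)) = 0.
(** When the product is a symmetric form with values in a line, this says that isotropic vectors lie
    in the radical: true in rank one, false for a hyperbolic plane. *)
Definition square_zero_ann := forall x, m x x = 0 -> forall y, m x y = 0.
Definition has_annihilator := exists x, x <> 0 /\ forall y, m x y = 0.
Definition reduced := forall x, m x x = 0 -> x = 0.
Definition no_index3 := forall x, m x (m x x) = 0 -> m x x = 0.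
Definition no_orthogonal_idempotents :=
  forall x y, m x x = x -> m y y = y -> m x y = 0 -> x = 0 \/ y = 0.
(* Distinguishes [P3_3] and the members of [P3_4]. *)
Definition eigenpair (a : K) := exists h x y,
  [/\ forall s t, s *: x + t *: y = 0 -> s = 0 /\ t = 0,
      m h x = x, m h y = a *: y & m x y = 0].
(* Recovers the parameter of [P3_16] up to sign. *)
Definition proportional_pair (a : K) := exists u v,
  [/\ m u v <> 0, m u u = 0, m v v = 0 & b u v = a *: m u v].
End Properties.

(* A signature lists the tests along one path of a decision tree, so the signatures of
   two distinct types contain some property together with its negation; only [P3_3] and
   the members of [P3_4] share theirs, as do the members of [P3_16]. *)
Definition signature (p : P3 K) (V : lmodType K) (m b : V -> V -> V) : Prop :=
  match p with
  | P3_1 => nil4 m /\ trivial_op m /\ trivial_op b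
  | P3_2 => nil4 m /\ trivial_op m /\ ~ trivial_op b /\ two_step_nilpotent b
  | P3_3 | P3_4 _ => nil4 m /\ trivial_op m /\ ~ trivial_op b /\
      ~ two_step_nilpotent b /\ metabelian b
  | P3_5 => nil4 m /\ trivial_op m /\ ~ trivial_op b /\
      ~ two_step_nilpotent b /\ ~ metabelian b
  | P3_13 => nil4 m /\ ~ trivial_op m /\ nil3 m /\ square_zero_ann m /\ trivial_op b
  | P3_14 => nil4 m /\ ~ trivial_op m /\ nil3 m /\ square_zero_ann m /\
      ~ trivial_op b /\ ~ two_step_nilpotent b
  | P3_15 => nil4 m /\ ~ trivial_op m /\ nil3 m /\ square_zero_ann m /\
      ~ trivial_op b /\ two_step_nilpotent b
  | P3_16 _ => nil4 m /\ ~ trivial_op m /\ nil3 m /\ ~ square_zero_ann m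
  | P3_6 => nil4 m /\ ~ trivial_op m /\ ~ nil3 m
  | P3_7 => ~ nil4 m /\ ~ has_annihilator m /\ reduced m
  | P3_8 => ~ nil4 m /\ ~ has_annihilator m /\ ~ reduced m /\ trivial_op b /\
      no_index3 m /\ ~ no_orthogonal_idempotents m
  | P3_9 => ~ nil4 m /\ ~ has_annihilator m /\ ~ reduced m /\ trivial_op b /\
      ~ no_index3 m
  | P3_17 => ~ nil4 m /\ ~ has_annihilator m /\ ~ reduced m /\ trivial_op b /\
      no_index3 m /\ no_orthogonal_idempotents m
  | P3_18 => ~ nil4 m /\ ~ has_annihilator m /\ ~ reduced m /\ ~ trivial_op b
  | P3_10 => ~ nil4 m /\ has_annihilator m /\ trivial_op b /\ no_index3 m /\
      square_zero_ann m /\ ~ no_orthogonal_idempotents m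
  | P3_11 => ~ nil4 m /\ has_annihilator m /\ trivial_op b /\ no_index3 m /\
      ~ square_zero_ann m
  | P3_12 => ~ nil4 m /\ has_annihilator m /\ trivial_op b /\ ~ no_index3 m
  | P3_19 => ~ nil4 m /\ has_annihilator m /\ trivial_op b /\ no_index3 m /\
      square_zero_ann m /\ no_orthogonal_idempotents m
  | P3_20 => ~ nil4 m /\ has_annihilator m /\ ~ trivial_op b
  end.

Section Invariance.
Variables (V W : lmodType K) (m b : V -> V -> V) (m' b' : W -> W -> W).
Variable f : V -> W.
Hypothesis flin : forall a x y, f (a *: x + y) = a *: f x + f y.
Hypothesis fbij : bijective f.
Hypothesis fm : forall x y, f (m x y) = m' (f x) (f y).
Hypothesis fb : forall x y, f (b x y) = b' (f x) (f y).

Let f0 : f 0 = 0.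
Proof. by have := flin (-1) 0 0; rewrite !scaleN1r oppr0 addr0 addNr. Qed.
Let finj : injective f := bij_inj fbij.
Let fsurj y : exists x, y = f x.
Proof. by case: fbij => g _ gK; exists (g y); rewrite gK. Qed.
Let feq0 x : f x = 0 -> x = 0.
Proof. by rewrite -{1}f0; apply: finj. Qed.
Let fZ a x : f (a *: x) = a *: f x.
Proof. by rewrite -[_ *: x]addr0 flin f0 addr0. Qed.

Lemma trivial_op_inv : trivial_op m -> trivial_op m'.
Proof. by move=> H x y; have [x' ->] := fsurj x; have [y' ->] := fsurj y; rewrite -fm H. Qed.
Lemma two_step_nilpotent_inv : two_step_nilpotent m -> two_step_nilpotent m'.
Proof.
move=> H x y z; have [x' ->] := fsurj x; have [y' ->] := fsurj y.
by have [z' ->] := fsurj z; rewrite -!fm H.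
Qed.
Lemma metabelian_inv : metabelian m -> metabelian m'.
Proof.
move=> H x y z t; have [x' ->] := fsurj x; have [y' ->] := fsurj y.
by have [z' ->] := fsurj z; have [t' ->] := fsurj t; rewrite -!fm H.
Qed.
Lemma nil3_inv : nil3 m -> nil3 m'.
Proof. by move=> H x; have [x' ->] := fsurj x; rewrite -!fm H. Qed.
Lemma nil4_inv : nil4 m -> nil4 m'.
Proof. by move=> H x; have [x' ->] := fsurj x; rewrite -!fm H. Qed.
Lemma square_zero_ann_inv : square_zero_ann m -> square_zero_ann m'.
Proof.
move=> H x; have [x' ->] := fsurj x; rewrite -fm => /feq0/H xy y.
by have [y' ->] := fsurj y; rewrite -fm xy.
Qed.
Lemma has_annihilator_inv : has_annihilator m -> has_annihilator m'.
Proof.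
move=> [x [x0 xy]]; exists (f x); split=> [/feq0//|y].
by have [y' ->] := fsurj y; rewrite -fm xy.
Qed.
Lemma reduced_inv : reduced m -> reduced m'.
Proof. by move=> H x; have [x' ->] := fsurj x; rewrite -fm => /feq0/H ->. Qed.
Lemma no_index3_inv : no_index3 m -> no_index3 m'.
Proof. by move=> H x; have [x' ->] := fsurj x; rewrite -!fm => /feq0/H ->. Qed.
Lemma no_orthogonal_idempotents_inv :
  no_orthogonal_idempotents m -> no_orthogonal_idempotents m'.
Proof.
move=> H x y; have [x' ->] := fsurj x; have [y' ->] := fsurj y.
rewrite -!fm => /finj xx /finj yy /feq0 xy.
by case: (H _ _ xx yy xy) => ->; [left|right].
Qed.
Lemma eigenpair_inv a : eigenpair m a -> eigenpair m' a.
Proof.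
move=> [h [x [y [ind hx hy xy]]]]; exists (f h), (f x), (f y); split.
- by move=> s t; rewrite -(fZ t) -flin => /feq0/ind.
- by rewrite -fm hx.
- by rewrite -fm hy fZ.
- by rewrite -fm xy.
Qed.
Lemma proportional_pair_inv a : proportional_pair m b a -> proportional_pair m' b' a.
Proof.
move=> [u [v [uv uu vv buv]]]; exists (f u), (f v); split.
- by rewrite -fm => /feq0.
- by rewrite -fm uu.
- by rewrite -fm vv.
- by rewrite -fm -fb buv fZ.
Qed.
End Invariance.

(** Signatures contain negations, so each property is needed in both directions; the inverse
    isomorphism supplies the second, and the equivalences become rewritable equalities. *)
Lemma signature_inv p (V W : lmodType K) m b m' b' :
  @poisson_iso K V W m b m' b' -> signature p m b -> signature p m' b'.
Proof.
move=> iso; have := poisson_iso_sym iso.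
case: iso => f [fl fbij fm fb] [g [gl gbij gm gb]].
have E0 : trivial_op m = trivial_op m'.
  by apply: propext; split; [exact: trivial_op_inv fl fbij fm
    |exact: trivial_op_inv gl gbij gm].
have E1 : trivial_op b = trivial_op b'.
  by apply: propext; split; [exact: trivial_op_inv fl fbij fb
    |exact: trivial_op_inv gl gbij gb].
have E2 : two_step_nilpotent b = two_step_nilpotent b'.
  by apply: propext; split; [exact: two_step_nilpotent_inv fl fbij fb
    |exact: two_step_nilpotent_inv gl gbij gb].
have E3 : metabelian b = metabelian b'.
  by apply: propext; split; [exact: metabelian_inv fl fbij fb
    |exact: metabelian_inv gl gbij gb].
have E4 : nil3 m = nil3 m'.
  by apply: propext; split; [exact: nil3_inv fl fbij fm
    |exact: nil3_inv gl gbij gm].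
have E5 : nil4 m = nil4 m'.
  by apply: propext; split; [exact: nil4_inv fl fbij fm
    |exact: nil4_inv gl gbij gm].
have E6 : square_zero_ann m = square_zero_ann m'.
  by apply: propext; split; [exact: square_zero_ann_inv fl fbij fm
    |exact: square_zero_ann_inv gl gbij gm].
have E7 : has_annihilator m = has_annihilator m'.
  by apply: propext; split; [exact: has_annihilator_inv fl fbij fm
    |exact: has_annihilator_inv gl gbij gm].
have E8 : reduced m = reduced m'.
  by apply: propext; split; [exact: reduced_inv fl fbij fm
    |exact: reduced_inv gl gbij gm].
have E9 : no_index3 m = no_index3 m'.
  by apply: propext; split; [exact: no_index3_inv fl fbij fm
    |exact: no_index3_inv gl gbij gm].
have E10 : no_orthogonal_idempotents m = no_orthogonal_idempotents m'.
  by apply: propext; split; [exact: no_orthogonal_idempotents_inv fl fbij fm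
    |exact: no_orthogonal_idempotents_inv gl gbij gm].
by rewrite /signature E0 E1 E2 E3 E4 E5 E6 E7 E8 E9 E10.
Qed.
End Invariants.

(** * Evaluating the invariants on the listed algebras *)

Ltac conjuncts := hnf; repeat match goal with |- _ /\ _ => split end.
Ltac identity := hnf; intros; rewrite !(mulPE, brPE) /=; apply: row3P; rewrite !mxE /=; ring.
(** [H] is a false vanishing statement at explicit vectors, and [c] is the nonzero value of its left
    side at coordinate [k]. *)
Ltac refute H k c := let eq0 := fresh in have /rowP/(_ k) := H;
  rewrite !(mulPE, brPE) /= !mxE /= => eq0;
  suff /eqP : c = 0 by [rewrite ?oppr_eq0 ?pnatr_eq0 ?oner_eq0];
  rewrite -[RHS]eq0; ring.

Section Separation.
Variable K : numFieldType.
Let e1 : 'rV[K]_3 := v3 1 0 0.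
Let e2 : 'rV[K]_3 := v3 0 1 0.
Let e3 : 'rV[K]_3 := v3 0 0 1.
Local Notation sig p := (signature p (@mulP K p) (@brP K p)).

Lemma v3_eq0 (a b c : K) : v3 a b c = 0 -> [/\ a = 0, b = 0 & c = 0].
Proof.
by move=> /rowP eq0; split;
  [have := eq0 i0|have := eq0 i1|have := eq0 i2]; rewrite !mxE.
Qed.

Lemma signature_1 : sig P3_1.
Proof. by conjuncts; identity. Qed.
Lemma signature_2 : sig P3_2.
Proof.
conjuncts; try identity.
by move=> H; refute (H e1 e2) i2 (1 : K).
Qed.
Lemma signature_3 : sig P3_3.
Proof.
conjuncts; try identity.
- by move=> H; refute (H e1 e2) i1 (1 : K).
- by move=> H; refute (H e1 e1 e2) i1 (1 : K).
Qed.
Lemma signature_4 a : sig (P3_4 a).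
Proof.
conjuncts; try identity.
- by move=> H; refute (H e1 e2) i1 (1 : K).
- by move=> H; refute (H e1 e1 e2) i1 (1 : K).
Qed.
Lemma signature_5 : sig P3_5.
Proof.
conjuncts; try identity.
- by move=> H; refute (H e1 e2) i2 (1 : K).
- by move=> H; refute (H e1 e2 e3) i2 (2 : K).
- by move=> H; refute (H e1 e2 e2 e3) i1 (- 4 : K).
Qed.
Lemma signature_6 : sig P3_6.
Proof.
conjuncts; try identity.
- by move=> H; refute (H e1 e1) i1 (1 : K).
- by move=> H; refute (H e1) i2 (1 : K).
Qed.

Lemma no_annihilator (p : P3 K) u :
  (forall x, mulP p x u = x) -> ~ has_annihilator (mulP p).
Proof. by move=> unit [x [x0 xy]]; apply: x0; rewrite -(unit x) xy. Qed.

Lemma annihilator_e3 (p : P3 K) : (forall y, mulP p e3 y = 0) -> has_annihilator (mulP p).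
Proof.
move=> H; exists e3; split=> // /v3_eq0[_ _ /eqP].
by rewrite oner_eq0.
Qed.

Lemma sqr_eq0 (a : K) : a * a = 0 -> a = 0.
Proof. by move=> /eqP; rewrite mulf_eq0 orbb => /eqP. Qed.
Lemma cube_eq0 (a : K) : a * (a * a) = 0 -> a = 0.
Proof. by move=> /eqP; rewrite !mulf_eq0 orbb orbb => /eqP. Qed.

Lemma signature_7 : sig P3_7.
Proof.
conjuncts.
- by move=> H; refute (H e1) i0 (1 : K).
- by apply: (@no_annihilator _ (v3 1 1 1)); identity.
- move=> x; rewrite mulPE => /v3_eq0[/sqr_eq0 x0 /sqr_eq0 x1 /sqr_eq0 x2].
  by apply: row3P; rewrite mxE.
Qed.
Lemma not_reduced (p : P3 K) : mulP p e3 e3 = 0 -> ~ reduced (mulP p).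
Proof. by move=> H /(_ _ H)/v3_eq0[_ _ /eqP]; rewrite oner_eq0. Qed.

Lemma orthogonal_e1_e2 (p : P3 K) :
  mulP p e1 e1 = e1 -> mulP p e2 e2 = e2 -> mulP p e1 e2 = 0 ->
  ~ no_orthogonal_idempotents (mulP p).
Proof.
move=> e11 e22 e12 /(_ _ _ e11 e22 e12)[] /v3_eq0[] /eqP; rewrite ?oner_eq0 // => _ /eqP.
by rewrite oner_eq0.
Qed.

Lemma signature_8 : sig P3_8.
Proof.
conjuncts.
- by move=> H; refute (H e1) i0 (1 : K).
- by apply: (@no_annihilator _ (v3 1 1 0)); identity.
- by apply: not_reduced; identity.
- identity.
- move=> x; rewrite !mulPE /= !mxE /= => /v3_eq0[/cube_eq0 -> /cube_eq0 -> _].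
  by apply: row3P; rewrite !mxE /=; ring.
- by apply: orthogonal_e1_e2; identity.
Qed.
Lemma signature_9 : sig P3_9.
Proof.
conjuncts.
- by move=> H; refute (H e1) i0 (1 : K).
- by apply: (@no_annihilator _ e1); identity.
- by apply: not_reduced; identity.
- identity.
- by move=> H; refute (H e2 ltac:(identity)) i2 (1 : K).
Qed.
Lemma signature_10 : sig P3_10.
Proof.
conjuncts.
- by move=> H; refute (H e1) i0 (1 : K).
- by apply: annihilator_e3; identity.
- identity.
- move=> x; rewrite !mulPE /= !mxE /= => /v3_eq0[/cube_eq0 -> /cube_eq0 -> _].
  by apply: row3P; rewrite !mxE /=; ring.
- move=> x; rewrite mulPE => /v3_eq0[/sqr_eq0 x0 /sqr_eq0 x1 _] y.
  by rewrite mulPE /= x0 x1; apply: row3P; rewrite !mxE /=; ring.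
- by apply: orthogonal_e1_e2; identity.
Qed.
Lemma signature_11 : sig P3_11.
Proof.
conjuncts.
- by move=> H; refute (H e1) i0 (1 : K).
- by apply: annihilator_e3; identity.
- identity.
- move=> x; rewrite !mulPE /= !mxE /= => /v3_eq0[/cube_eq0 -> _ _].
  by apply: row3P; rewrite !mxE /=; ring.
- by move=> H; refute (H e2 ltac:(identity) e1) i1 (1 : K).
Qed.
Lemma signature_12 : sig P3_12.
Proof.
conjuncts.
- by move=> H; refute (H e1) i0 (1 : K).
- by apply: annihilator_e3; identity.
- identity.
- by move=> H; refute (H e2 ltac:(identity)) i2 (1 : K).
Qed.
Lemma signature_13 : sig P3_13.
Proof.
conjuncts; try identity.
- by move=> H; refute (H e1 e1) i1 (1 : K).
- move=> x; rewrite mulPE => /v3_eq0[_ /sqr_eq0 x0 _] y.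
  by rewrite mulPE /= x0; apply: row3P; rewrite !mxE /=; ring.
Qed.
Lemma signature_14 : sig P3_14.
Proof.
conjuncts; try identity.
- by move=> H; refute (H e1 e1) i1 (1 : K).
- move=> x; rewrite mulPE => /v3_eq0[_ /sqr_eq0 x0 _] y.
  by rewrite mulPE /= x0; apply: row3P; rewrite !mxE /=; ring.
- by move=> H; refute (H e1 e3) i2 (1 : K).
- by move=> H; refute (H e1 e1 e3) i2 (1 : K).
Qed.
Lemma signature_15 : sig P3_15.
Proof.
conjuncts; try identity.
- by move=> H; refute (H e1 e1) i1 (1 : K).
- move=> x; rewrite mulPE => /v3_eq0[_ /sqr_eq0 x0 _] y.
  by rewrite mulPE /= x0; apply: row3P; rewrite !mxE /=; ring.
- by move=> H; refute (H e1 e3) i1 (1 : K).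
Qed.
Lemma signature_16 a : sig (P3_16 a).
Proof.
conjuncts; try identity.
- by move=> H; refute (H e1 e2) i2 (1 : K).
- by move=> H; refute (H e1 ltac:(identity) e2) i2 (1 : K).
Qed.

(** The first coordinate is a character whose kernel has zero squares. Of two orthogonal idempotents
    one lies in the kernel, hence equals its own square, zero. *)
Lemma local_idempotents (p : P3 K) :
  (forall x y : 'rV[K]_3, mulP p x y 0 i0 = x 0 i0 * y 0 i0) ->
  (forall x : 'rV[K]_3, x 0 i0 = 0 -> mulP p x x = 0) -> no_orthogonal_idempotents (mulP p).
Proof.
move=> H0 Hsq x y xx yy xy; have := H0 x y.
rewrite xy mxE => /esym/eqP; rewrite mulf_eq0 => /orP[]/eqP/Hsq z.
  by left; rewrite -xx.
by right; rewrite -yy.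
Qed.

Lemma signature_17 : sig P3_17.
Proof.
conjuncts.
- by move=> H; refute (H e1) i0 (1 : K).
- by apply: (@no_annihilator _ e1); identity.
- by apply: not_reduced; identity.
- identity.
- move=> x; rewrite !mulPE /= !mxE /= => /v3_eq0[/cube_eq0 -> _ _].
  by apply: row3P; rewrite !mxE /=; ring.
- apply: local_idempotents => [x y|x x0]; rewrite !mulPE /= ?mxE //= x0.
  by apply: row3P; rewrite !mxE /=; ring.
Qed.
Lemma signature_18 : sig P3_18.
Proof.
conjuncts.
- by move=> H; refute (H e1) i0 (1 : K).
- by apply: (@no_annihilator _ e1); identity.
- by apply: not_reduced; identity.
- by move=> H; refute (H e2 e3) i1 (1 : K).
Qed.
Lemma signature_19 : sig P3_19.
Proof.
conjuncts.
- by move=> H; refute (H e1) i0 (1 : K).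
- by apply: annihilator_e3; identity.
- identity.
- move=> x; rewrite !mulPE /= !mxE /= => /v3_eq0[/cube_eq0 -> _ _].
  by apply: row3P; rewrite !mxE /=; ring.
- move=> x; rewrite mulPE => /v3_eq0[/sqr_eq0 x0 _ _] y.
  by rewrite mulPE /= x0; apply: row3P; rewrite !mxE /=; ring.
- apply: local_idempotents => [x y|x x0]; rewrite !mulPE /= ?mxE //= x0.
  by apply: row3P; rewrite !mxE /=; ring.
Qed.
Lemma signature_20 : sig P3_20.
Proof.
conjuncts.
- by move=> H; refute (H e1) i0 (1 : K).
- by apply: annihilator_e3; identity.
- by move=> H; refute (H e2 e3) i1 (1 : K).
Qed.

Lemma signatureP (p : P3 K) : sig p.
Proof.
case: p => [|||a||||||||||||a||||].
- exact: signature_1. - exact: signature_2. - exact: signature_3. - exact: signature_4.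
- exact: signature_5. - exact: signature_6. - exact: signature_7. - exact: signature_8.
- exact: signature_9. - exact: signature_10. - exact: signature_11. - exact: signature_12.
- exact: signature_13. - exact: signature_14. - exact: signature_15. - exact: signature_16.
- exact: signature_17. - exact: signature_18. - exact: signature_19. - exact: signature_20.
Qed.

(** * Recovering the parameters of the two families *)

Lemma indep_minor (x y : 'rV[K]_3) :
  (forall s t, s *: x + t *: y = 0 -> s = 0 /\ t = 0) ->
  x 0 i0 = 0 -> y 0 i0 = 0 -> x 0 i1 * y 0 i2 != x 0 i2 * y 0 i1.
Proof.
move=> ind x0 y0; apply/eqP => d0.
have [_ /eqP] : y 0 i2 = 0 /\ - x 0 i2 = 0.
  by apply: ind; apply: row3P; rewrite !mxE ?x0 ?y0 ?[y 0 i2 * _]mulrC ?d0; ring.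
rewrite oppr_eq0 => /eqP x2.
have [_ /eqP] : y 0 i1 = 0 /\ - x 0 i1 = 0.
  by apply: ind; apply: row3P; rewrite !mxE ?x0 ?y0 ?[y 0 i1 * _]mulrC -?d0 ?x2; ring.
rewrite oppr_eq0 => /eqP x1.
have [/eqP] : (1 : K) = 0 /\ (0 : K) = 0.
  by apply: ind; apply: row3P; rewrite !mxE ?x0 ?x1 ?x2; ring.
by rewrite oner_eq0.
Qed.

Lemma indep_neq0 (x y : 'rV[K]_3) :
  (forall s t, s *: x + t *: y = 0 -> s = 0 /\ t = 0) -> x != 0.
Proof.
move=> ind; apply/eqP => x0; have [/eqP] : (1 : K) = 0 /\ (0 : K) = 0.
  by apply: ind; rewrite x0 scaler0 scale0r addr0.
by rewrite oner_eq0.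
Qed.

Lemma eigenpair_4 a : eigenpair (@brP K (P3_4 a)) a.
Proof.
exists e1, e2, e3; split; try identity.
move=> s t; rewrite (_ : s *: e2 + t *: e3 = v3 0 s t) => [/v3_eq0[]//|].
by apply: row3P; rewrite !mxE /=; ring.
Qed.

(** Both vectors lie in the plane of [e2], [e3], where [b h] is [h_0] times diag(1, [c]). So 1 and
    [a] are [h_0] and [c h_0] in some order. *)
Lemma eigenpair_4_inv a c : eigenpair (@brP K (P3_4 c)) a -> a = c \/ a * c = 1.
Proof.
move=> [h [x [y [ind hx hy xy]]]].
move: hx hy xy; rewrite !brPE /= => hx hy xy.
have x0 : x 0 i0 = 0 by rewrite -hx mxE.
have xn0 := indep_neq0 ind.
have [_ xy1 xy2] := v3_eq0 xy.
have x1 : x 0 i1 = h 0 i0 * x 0 i1 by rewrite -{1}hx !mxE /= x0; ring.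
have x2 : x 0 i2 = c * h 0 i0 * x 0 i2 by rewrite -{1}hx !mxE /= x0; ring.
(* Here the commuting condition on [x], [y] is essential: without it [y = h] would always be an
   eigenvector for 0. *)
have y0 : y 0 i0 = 0.
  apply/eqP; apply: contraTT xn0 => y0; rewrite negbK; apply/eqP.
  have x1' : x 0 i1 = 0.
    by apply: (mulIf y0); rewrite mul0r -[RHS]oppr0 -xy1 x0; ring.
  apply: row3P; rewrite mxE // x2.
  apply: (mulIf y0); rewrite mul0r.
  have -> : c * h 0 i0 * x 0 i2 * y 0 i0 = - h 0 i0 * (c * (x 0 i0 * y 0 i2 - x 0 i2 * y 0 i0)).
    by rewrite x0; ring.
  by rewrite xy2 mulr0.
have y1 : a * y 0 i1 = h 0 i0 * y 0 i1.
  by have /rowP/(_ i1) := hy; rewrite !mxE /= y0 => <-; ring.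
have y2 : a * y 0 i2 = c * h 0 i0 * y 0 i2.
  by have /rowP/(_ i2) := hy; rewrite !mxE /= y0 => <-; ring.
have := indep_minor ind x0 y0.
have [x1z|x1n] := eqVneq (x 0 i1) 0.
  rewrite x1z mul0r eq_sym mulf_eq0 negb_or => /andP[x2n y1n]; right.
  rewrite (mulIf y1n y1) mulrC; apply: (mulIf x2n); by rewrite mul1r -x2.
have h1 : h 0 i0 = 1 by apply: (mulIf x1n); rewrite mul1r -x1.
have [y2z|y2n] := eqVneq (y 0 i2) 0; last first.
  by left; apply: (mulIf y2n); rewrite y2 h1 mulr1.
rewrite y2z mulr0 eq_sym mulf_eq0 negb_or => /andP[x2n y1n]; left.
rewrite (mulIf y1n y1) h1; apply: (mulIf x2n).
by rewrite mul1r {1}x2 h1 mulr1.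
Qed.

(** As for [P3_4], both vectors would lie in the plane of [e2], [e3]; there [b h] is [h_0] times a
    Jordan block, with [h_0 = 1], and has no two independent eigenvectors. *)
Lemma eigenpair_3_inv a : ~ eigenpair (@brP K P3_3) a.
Proof.
move=> [h [x [y [ind hx hy xy]]]].
move: hx hy xy; rewrite !brPE /= => hx hy xy.
have x0 : x 0 i0 = 0 by rewrite -hx mxE.
have xn0 := indep_neq0 ind.
have [_ xy1 xy2] := v3_eq0 xy.
have x1 : x 0 i1 = h 0 i0 * (x 0 i1 + x 0 i2) by rewrite -{1}hx !mxE /= x0; ring.
have x2 : x 0 i2 = h 0 i0 * x 0 i2 by rewrite -{1}hx !mxE /= x0; ring.
have y0 : y 0 i0 = 0.
  apply/eqP; apply: contraTT xn0 => y0; rewrite negbK; apply/eqP.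
  have x2' : x 0 i2 = 0.
    by apply: (mulIf y0); rewrite mul0r -[RHS]oppr0 -xy2 x0; ring.
  apply: row3P; rewrite mxE //.
  by apply: (mulIf y0); rewrite mul0r -[RHS]oppr0 -xy1 x0 x2'; ring.
have y1 : a * y 0 i1 = h 0 i0 * (y 0 i1 + y 0 i2).
  by have /rowP/(_ i1) := hy; rewrite !mxE /= y0 => <-; ring.
have y2 : a * y 0 i2 = h 0 i0 * y 0 i2.
  by have /rowP/(_ i2) := hy; rewrite !mxE /= y0 => <-; ring.
have := indep_minor ind x0 y0.
have x2z : x 0 i2 = 0.
  apply/eqP/negP => /negP x2n; have h1 : h 0 i0 = 1.
    by apply: (mulIf x2n); rewrite mul1r -x2.
  case/eqP: x2n; apply: (addrI (x 0 i1)).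
  by rewrite addr0 [RHS]x1 h1 mul1r.
rewrite x2z mul0r mulf_eq0 negb_or => /andP[x1n y2n].
have h1 : h 0 i0 = 1 by apply: (mulIf x1n); rewrite mul1r [RHS]x1 x2z addr0.
have a1 : a = 1 by rewrite (mulIf y2n y2) h1.
case/eqP: y2n; apply: (addrI (y 0 i1)).
by rewrite addr0 -[RHS]mul1r -a1 y1 h1 mul1r.
Qed.

Lemma proportional_16 a :
  proportional_pair (@mulP K (P3_16 a)) (@brP K (P3_16 a)) a.
Proof.
exists e1, e2; split; try identity.
by move=> H; refute H i2 (1 : K).
Qed.

(** Modulo [e3] the square-zero elements form the two lines of [e1] and [e2]. A nonzero product puts
    [u] and [v] on different lines, and their order decides the sign of [a]. *)
Lemma proportional_16_inv a c :
  proportional_pair (@mulP K (P3_16 c)) (@brP K (P3_16 c)) a -> a ^+ 2 = c ^+ 2.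
Proof.
move=> [u [v [+ + + +]]]; rewrite !(mulPE, brPE) /= => uv /v3_eq0[_ _ uu] /v3_eq0[_ _ vv].
move=> /rowP/(_ i2); rewrite !mxE /= => buv.
have {}uv : u 0 i0 * v 0 i1 + u 0 i1 * v 0 i0 != 0.
  by apply/eqP => uv0; apply: uv; rewrite uv0; apply: row3P; rewrite !mxE.
have two_eq0 (s : K) : s + s = 0 -> s = 0.
  by move/eqP; rewrite -mulr2n -mulr_natr mulf_eq0 pnatr_eq0 orbF => /eqP.
have /eqP : u 0 i0 * u 0 i1 = 0 by apply: two_eq0; rewrite -[RHS]uu; ring.
have /eqP : v 0 i0 * v 0 i1 = 0 by apply: two_eq0; rewrite -[RHS]vv; ring.
rewrite !mulf_eq0 => vz /orP[/eqP u0|/eqP u1].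
  move: uv buv; rewrite u0 !mul0r add0r sub0r => uv buv.
  have -> : a = - c by apply: (mulIf uv); rewrite -buv; ring.
  by rewrite sqrrN.
move: uv buv; rewrite u1 !mul0r addr0 subr0 => uv buv.
by have -> : a = c by apply: (mulIf uv); rewrite -buv.
Qed.

Lemma iso_listed (p q : P3 K) :
  poisson_iso (mulP p) (brP p) (mulP q) (brP q) -> listed_iso p q.
Proof.
move=> iso; have sp := signature_inv iso (signatureP p); have sq := signatureP q.
have eig a : eigenpair (brP p) a -> eigenpair (brP q) a.
  by case: iso => f [fl fbij fm fb]; apply: (eigenpair_inv fl fbij fb).
have eig' a : eigenpair (brP q) a -> eigenpair (brP p) a.
  by case: (poisson_iso_sym iso) => f [fl fbij fm fb]; apply: (eigenpair_inv fl fbij fb).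
have prop a : proportional_pair (mulP p) (brP p) a -> proportional_pair (mulP q) (brP q) a.
  by case: iso => f [fl fbij fm fb]; apply: (proportional_pair_inv fl fbij fm fb).
case: p iso sp eig eig' prop => [|||a||||||||||||a||||] iso;
  case: q iso sq => [|||c||||||||||||c||||] iso sq sp eig eig' prop //=;
  (* Contradictory signatures are refuted propositionally; what remains is [P3_3] against [P3_4]
     both ways and each family against itself. *)
  try (clear iso eig eig' prop; hnf in sp; hnf in sq; tauto).
- by case: (eigenpair_3_inv (eig' _ (eigenpair_4 c))).
- by case: (eigenpair_3_inv (eig _ (eigenpair_4 a))).
- case: (eigenpair_4_inv (eig _ (eigenpair_4 a))) => [|ac1]; first by right.
  have c0 : c != 0.
    by apply/eqP => c0; move/eqP: ac1; rewrite c0 mulr0 eq_sym oner_eq0.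
  have a0 : a != 0.
    by apply/eqP => a0; move/eqP: ac1; rewrite a0 mul0r eq_sym oner_eq0.
  by left; split=> //; split=> //; right; apply: (mulIf c0); rewrite ac1 mulVf.
- exact: (proportional_16_inv (prop _ (proportional_16 a))).
Qed.

Lemma poisson_iso_refl (V : lmodType K) m b : @poisson_iso K V V m b m b.
Proof. by exists id; split=> //; exists id. Qed.

Lemma listed_iso_iso (p q : P3 K) :
  listed_iso p q -> poisson_iso (mulP p) (brP p) (mulP q) (brP q).
Proof.
have D123 : det3 e1 e2 e3 = 1 by rewrite /det3 !mxE /=; ring.
case: p => [|||a||||||||||||a||||]; case: q => [|||c||||||||||||c||||] //=;
  try (by move=> _; apply: poisson_iso_refl).
- case=> [[a0 [c0 [->|ac]]]|->]; [exact: poisson_iso_refl| |exact: poisson_iso_refl].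
  (* Multiplying [e1] by [c] turns the eigenvalues 1 and [c^-1] of [e2] and [e3] into [c] and 1, so
     these two vectors trade places. *)
  subst a; apply: (iso_of_basis (P3_poisson _) (e1 := c *: e1) (e2 := e3) (e3 := e2)).
  + rewrite (_ : det3 _ _ _ = - c * det3 e1 e2 e3); last by rewrite /det3 !mxE; ring.
    by rewrite D123 mulr1 oppr_eq0.
  + table; split; rewrite mulPE /=; apply: row3P; rewrite !mxE /=; ring.
  + table; split; rewrite mulPE /=; apply: row3P; rewrite !mxE /=; ring.
  + table; split; rewrite brPE /=; apply: row3P; rewrite !mxE /=; field => //.
- move=> /eqP; rewrite eqf_sqr => /orP[/eqP->|/eqP ac]; first exact: poisson_iso_refl.
  (* Swapping [e1] and [e2] keeps the commutative product and negates the bracket. *)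
  subst a; apply: (iso_of_basis (P3_poisson _) (e1 := e2) (e2 := e1) (e3 := e3)).
  + rewrite (_ : det3 _ _ _ = - det3 e1 e2 e3); last by rewrite /det3 !mxE; ring.
    by rewrite D123 oppr_eq0 oner_eq0.
  + table; split; rewrite mulPE /=; apply: row3P; rewrite !mxE /=; ring.
  + table; split; rewrite mulPE /=; apply: row3P; rewrite !mxE /=; ring.
  + table; split; rewrite brPE /=; apply: row3P; rewrite !mxE /=; ring.
Qed.
End Separation.

Theorem theorem2p3 (R : realType) :
                                                
  (forall p : P3 R[i], is_poisson (@mulP R[i] p) (@brP R[i] p)) /\
                      
  (forall (V : vectType R[i]) (mul br : V -> V -> V),
      \dim (fullv : {vspace V}) = 3%N -> is_poisson mul br ->
      exists p : P3 R[i], poisson_iso mul br (@mulP R[i] p) (@brP R[i] p)) /\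
                                                    
  (forall p q : P3 R[i],
      poisson_iso (@mulP R[i] p) (@brP R[i] p) (@mulP R[i] q) (@brP R[i] q)
      <-> listed_iso p q).
Proof.
split; first by move=> p; exact: P3_poisson.
split; first by move=> V mul br dimV P; exact: classification dimV P.
by move=> p q; split; [exact: iso_listed|exact: listed_iso_iso].
Qed.
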